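(* Let $j,k,l\in\mathbb{Z}$ and let $\mathcal{K}^{+}_{j,k,l}$ and $\mathcal{K}^{-}_{j,k,l}$ be the knots obtained as closures of the 3-strand braids $$\sigma_1\,\sigma_2^{\pm(1+2j)}\,F_3^{\,l}\,E_3^{\,k},\qquad F_3=(\sigma_2\sigma_1)^3,\quad E_3=\sigma_1\sigma_2^2\sigma_1,$$ with the sign $+$ and $-$ respectively. Then each $\mathcal{K}=\mathcal{K}^{\pm}_{j,k,l}$ is HZ-factorisable and satisfies the HOMFLY--PT/Kauffman relation $$H(\mathcal{K};A,z)=\widetilde{KF}_{\rm even}(\mathcal{K};A,z)-\frac{z}{A-A^{-1}}\,\widetilde{KF}_{\rm odd}(\mathcal{K};A,z),$$ where $$\widetilde{KF}_{\rm even/odd}(\mathcal{K};A,z)=\tfrac12\bigl(KF(\mathcal{K};iA,iz)\pm KF(\mathcal{K};iA,-iz)\bigr)$$ ($+$ for even, $-$ for odd).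
   Context: Braids: $\sigma_1,\sigma_2$ are the standard generators of the braid group $B_3$; $\sigma_i$ is a positive crossing when both strands are oriented in the same (braid) direction. The writhe $w$ of an oriented diagram is the sum of the signs of its crossings. HOMFLY--PT polynomial: $H(\mathcal{K};A,z)$ is the oriented link invariant with $H(\text{unknot})=1$ and $A\,H(L_+)-A^{-1}H(L_-)=z\,H(L_0)$, where $L_+,L_-,L_0$ differ at one place by a positive crossing, a negative crossing, and the oriented smoothing. Its unnormalised version is $\bar H=\frac{A-A^{-1}}{z}H$. We write $z=q-q^{-1}$ when using the variable $q$. Kauffman polynomial: $KF(\mathcal{K};A,z)=A^{-w}L(\mathcal{K};A,z)$, where $L$ is the regular isotopy invariant of unoriented diagrams with $L(\bigcirc)=1$, $L(D_+)+L(D_-)=z\,(L(D_0)+L(D_\infty))$ (where $D_\pm$ are diagrams differing only by switching one crossing and $D_0,D_\infty$ are the two smoothings of that crossing), and such that a curl of writhe $\pm1$ can be removed at the cost of a factor $A^{\pm1}$. Harer--Zagier (HZ) transform: $Z(\mathcal{K};\lambda,q)=\sum_{N=0}^{\infty}\bar H(\mathcal{K};A=q^N,z=q-q^{-1})\,\lambda^N$, which is a rational function of $\lambda$ and $q$. A knot $\mathcal{K}$ presented as the closure of an $m$-strand braid is HZ-factorisable if there are integers $\alpha_0,\dots,\alpha_{m-2}$ and $\beta_0,\dots,\beta_m$ with $$Z(\mathcal{K};\lambda,q)=\frac{\lambda\prod_{i=0}^{m-2}(1-\lambda q^{\alpha_i})}{\prod_{i=0}^{m}(1-\lambda q^{\beta_i})}.$$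 Here $m=3$. *)

(* Defs.v *)
From HB Require Import structures.
From mathcomp Require Import all_boot all_order all_algebra.
Set Implicit Arguments.
Unset Strict Implicit.
Unset Printing Implicit Defensive.
Import GRing.Theory.
Local Open Scope ring_scope.

(** * Link diagrams

    A link diagram in general position with respect to the height function is
    read from bottom to top as a sequence of elementary events.  An event is
    given by its kind and the (0-based) position of the leftmost strand on
    which it acts.  [Cup o] is a local minimum, [Cap] a local maximum, and
    [Cross b] a crossing of two neighbouring strands, where [b = true] iff the
    over-strand goes from bottom left to top right.

    Strands carry labels in [T].  For oriented diagrams [T = bool], [true]
    meaning "upwards"; for unoriented diagrams [T = unit].  The two strands
    created by [Cup o] have labels [o] and [dual o], in this order. *)

Inductive kind (T : Type) := Cup of T | Cap | Cross of bool.
Arguments Cap {T}.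
Arguments Cross {T} _.

Notation event T := (kind T * nat)%type.
Notation diagram T := (seq (event T)).
Notation odiagram := (diagram bool).
Notation udiagram := (diagram unit).

Definition width_in (T : Type) (k : kind T) : nat :=
  if k is Cup _ then 0%N else 2%N.
Definition width_out (T : Type) (k : kind T) : nat :=
  if k is Cap then 0%N else 2%N.

(* [s] lists the labels of the strands just below the event. *)
Definition step (T : eqType) (dual : T -> T) (s : seq T) (e : event T)
    : option (seq T) :=
  let: (k, i) := e in
  if (size s < i + width_in k)%N then None else
  match k, drop i s with
  | Cup o, t => Some (take i s ++ [:: o, dual o & t])
  | Cap, x :: y :: t => if y == dual x then Some (take i s ++ t) else None
  | Cross _, x :: y :: t => Some (take i s ++ [:: y, x & t])
  | _, _ => None
  end.

Definition run (T : eqType) (dual : T -> T) (s : seq T) (D : diagram T)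
    : option (seq T) :=
  foldl (fun os e => obind (fun s' => step dual s' e) os) (Some s) D.

(* The sequences of events that are diagrams of (oriented) links. *)
Definition link_diagram (T : eqType) (dual : T -> T) (D : diagram T) : bool :=
  run dual [::] D == Some [::].

Definition erase (D : odiagram) : udiagram :=
  [seq (match e.1 with Cup _ => Cup tt | Cap => Cap | Cross b => Cross b end,
        e.2) | e <- D].

(** * Regular isotopy

    The elementary moves are the planar isotopies of diagrams in Morse position
    (exchange of distant events, cancellation of a maximum with a minimum,
    sliding a strand across an extremum) and the Reidemeister moves II and III.
    Labels need no further condition: they are forced by the requirement, in
    [regular_invariant] below, that both sides of a move give link
    diagrams. *)

Inductive move (T : Type) : diagram T -> diagram T -> Prop :=
| move_far (k k' : kind T) i j : (j + width_in k' <= i)%N ->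
    move [:: (k, i); (k', j)]
         [:: (k', j); (k, (i + width_out k' - width_in k')%N)]
| move_zigzagl o i : move [:: (Cup o, i); (Cap, i.+1)] [::]
| move_zigzagr o i : move [:: (Cup o, i.+1); (Cap, i)] [::]
| move_slide_cap b i :
    move [:: (Cross b, i); (Cap, i.+1)] [:: (Cross (~~ b), i.+1); (Cap, i)]
| move_slide_cup o b i :
    move [:: (Cup o, i.+1); (Cross b, i)] [:: (Cup o, i); (Cross (~~ b), i.+1)]
| move_R2 b i : move [:: (Cross b, i); (Cross (~~ b), i)] [::]
| move_R3 b i :
    move [:: (Cross b, i); (Cross b, i.+1); (Cross b, i)]
         [:: (Cross b, i.+1); (Cross b, i); (Cross b, i.+1)].

(* [curl dual e D D'] : D is D' with one additional curl, whose writhe is 1 if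
   [e = true] and -1 otherwise.  Near an extremum the two strands of the curl
   are antiparallel, so that the sign of [Cross b] is opposite to [b]. *)
Inductive curl (T : Type) (dual : T -> T)
    : bool -> diagram T -> diagram T -> Prop :=
| curl_right o b i :
    curl dual b [:: (Cup o, i.+1); (Cross b, i); (Cap, i.+1)] [::]
| curl_left o b i :
    curl dual b [:: (Cup o, i); (Cross b, i.+1); (Cap, i)] [::]
| curl_cap b i : curl dual (~~ b) [:: (Cross b, i); (Cap, i)] [:: (Cap, i)]
| curl_cup o b i :
    curl dual (~~ b) [:: (Cup o, i); (Cross b, i)] [:: (Cup (dual o), i)].

Definition regular_invariant (T : eqType) (dual : T -> T) (F : Type)
    (f : diagram T -> F) : Prop :=
  forall u D D' v, move D D' ->
    link_diagram dual (u ++ D ++ v) -> link_diagram dual (u ++ D' ++ v) ->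
    f (u ++ D ++ v) = f (u ++ D' ++ v).

(* Adding a curl of writhe 1 (resp. -1) multiplies [f] by [c] (resp. [c^-1]);
   for [c = 1] this is invariance under Reidemeister move I. *)
Definition curl_factor (T : eqType) (dual : T -> T) (F : fieldType) (c : F)
    (f : diagram T -> F) : Prop :=
  forall e u D D' v, curl dual e D D' ->
    link_diagram dual (u ++ D ++ v) -> link_diagram dual (u ++ D' ++ v) ->
    f (u ++ D ++ v) = (if e then c else c^-1) * f (u ++ D' ++ v).

(** * The HOMFLY--PT polynomial

    The invariant with parameters A and z in a field F; when A and z are
    indeterminates (e.g. F = C(A, z)) its values are the polynomials, otherwise
    the values of these polynomials.

    [x] and [y] are the labels of the two strands below the crossing; [Cross b]
    is positive iff [b = (x == y)].  The oriented smoothing of a crossing of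
    antiparallel strands is a maximum followed by a minimum. *)

Definition smoothing (x y : bool) (i : nat) : odiagram :=
  if x == y then [::] else [:: (Cap, i); (Cup y, i)].

Definition homfly_skein (F : fieldType) (A z : F) (H : odiagram -> F) : Prop :=
  forall u v i s, run negb [::] u = Some s ->
    link_diagram negb (u ++ (Cross true, i) :: v) ->
    let x := nth false s i in let y := nth false s i.+1 in
    A * H (u ++ (Cross (x == y), i) :: v)
      - A^-1 * H (u ++ (Cross (x != y), i) :: v)
    = z * H (u ++ smoothing x y i ++ v).

Definition is_homfly (F : fieldType) (A z : F) (H : odiagram -> F) : Prop :=
  [/\ regular_invariant negb H,
      curl_factor negb 1 H,
      forall o, H [:: (Cup o, 0%N); (Cap, 0%N)] = 1
    & homfly_skein A z H].

(** * The Kauffman polynomial *)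

Definition kauffman_skein (F : fieldType) (z : F) (L : udiagram -> F) : Prop :=
  forall u v i, link_diagram id (u ++ (Cross true, i) :: v) ->
    L (u ++ (Cross true, i) :: v) + L (u ++ (Cross false, i) :: v)
    = z * (L (u ++ v) + L (u ++ [:: (Cap, i); (Cup tt, i)] ++ v)).

Definition is_kauffman (F : fieldType) (A z : F) (L : udiagram -> F) : Prop :=
  [/\ regular_invariant id L,
      curl_factor id A L,
      L [:: (Cup tt, 0%N); (Cap, 0%N)] = 1
    & kauffman_skein z L].

Definition crossing_sign (s : seq bool) (e : event bool) : int :=
  if e is (Cross b, i) then
    if b == (nth false s i == nth false s i.+1) then 1 else -1
  else 0.

Fixpoint writhe_from (s : seq bool) (D : odiagram) : int :=
  if D is e :: D' then
    crossing_sign s e + writhe_from (odflt [::] (step negb s e)) D'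
  else 0.

Definition writhe (D : odiagram) : int := writhe_from [::] D.

Definition KF (F : fieldType) (L : F -> F -> udiagram -> F) (D : odiagram)
    (A z : F) : F :=
  A ^ (- writhe D) * L A z (erase D).

Definition KF_even (F : fieldType) (I : F) (L : F -> F -> udiagram -> F)
    (D : odiagram) (A z : F) : F :=
  2%:R^-1 * (KF L D (I * A) (I * z) + KF L D (I * A) (- (I * z))).

Definition KF_odd (F : fieldType) (I : F) (L : F -> F -> udiagram -> F)
    (D : odiagram) (A z : F) : F :=
  2%:R^-1 * (KF L D (I * A) (I * z) - KF L D (I * A) (- (I * z))).

(** * Braids and their closures

    A braid is given by a word in the letters (i, true) and (i, false), which
    stand for the generator crossing the strands at the 0-based positions i and
    i + 1, and for its inverse. *)

Definition braid := seq (nat * bool).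

Definition sigma1 : braid := [:: (0%N, true)].
Definition sigma2 : braid := [:: (1%N, true)].

Definition binv (w : braid) : braid := rev [seq (c.1, ~~ c.2) | c <- w].

Definition bexp (w : braid) (n : int) : braid :=
  match n with
  | Posz m => flatten (nseq m w)
  | Negz m => flatten (nseq m.+1 (binv w))
  end.

(* The braid occupies the strands 0, ..., m-1, oriented upwards; the strands
   m, ..., 2m-1 close it up. *)
Definition braid_closure (m : nat) (w : braid) : odiagram :=
  [seq (Cup true, i) | i <- iota 0 m] ++ [seq (Cross c.2, c.1) | c <- w]
  ++ [seq (Cap, i) | i <- rev (iota 0 m)].

Definition F3 : braid := bexp (sigma2 ++ sigma1) 3.
Definition E3 : braid := sigma1 ++ bexp sigma2 2 ++ sigma1.

(* [neg = false] gives the sign +, [neg = true] the sign -. *)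
Definition Kjkl (neg : bool) (j k l : int) : braid :=
  sigma1 ++ bexp sigma2 ((-1) ^+ neg * (1 + 2 * j)) ++ bexp F3 l ++ bexp E3 k.

(** * The Harer--Zagier transform *)

Definition homfly_bar (F : fieldType) (H : F -> F -> odiagram -> F)
    (D : odiagram) (A z : F) : F :=
  (A - A^-1) / z * H A z D.

(* The coefficient of lambda^N in Z(D; lambda, q). *)
Definition HZ_coef (F : fieldType) (H : F -> F -> odiagram -> F)
    (D : odiagram) (q : F) (N : nat) : F :=
  homfly_bar H D (q ^+ N) (q - q^-1).

(* The power series with coefficients [c] is the expansion of P / Q, that is,
   Q times it is P (used for Q with constant coefficient 1). *)
Definition is_expansion (F : fieldType) (c : nat -> F) (P Q : {poly F}) : Prop :=
  forall n : nat, \sum_(i < n.+1) Q`_i * c (n - i)%N = P`_n.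

Definition HZ_factorisable (F : fieldType) (H : F -> F -> odiagram -> F)
    (m : nat) (w : braid) : Prop :=
  exists (alpha : 'I_m.-1 -> int) (beta : 'I_m.+1 -> int),
  forall q : F, q != 0 -> q - q^-1 != 0 ->
    is_expansion (HZ_coef H (braid_closure m w) q)
      ('X * \prod_i (1 - q ^ alpha i *: 'X))
      (\prod_i (1 - q ^ beta i *: 'X)).

(* Main.v *)
(** The full twist F3 is central and E3 = F3 sigma2^-2, so every braid of the family
    equals sigma1 sigma2^n F3^p in B_3, with n odd and p = k + l.

    The functional w -> A^(writhe w) H(closure of w) is a trace on the Hecke algebra
    of B_3, hence determined by its values at 1, sigma1 and sigma1 sigma2.  For
    A = q^N it is therefore a combination of the two linear characters and of the
    character of the Burau representation, on which F3 acts trivially.  The weights,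
    as functions of N, expand lambda^i / prod (1 - lambda q^(+-1, +-3)), i = 1, 2, 3,
    and the numerator obtained for n odd is a product of two linear factors.

    The normalised Kauffman functionals are not Hecke traces, but a closure
    containing a turnback is multiplied by A^-2 when a full twist is inserted.  So
    w -> f (w F3) - A^-2 f w is a Hecke trace for the difference f of the two sides
    of the relation; it vanishes on three words that determine it.  Thus
    f (w F3) = A^-2 f w, and the skein recurrence in n, in which the turnback terms
    of the two Kauffman functionals cancel for odd n, gives f = 0. *)
Require Import Defs.
From Stdlib Require Import Setoid Morphisms.
From mathcomp Require Import all_boot all_order all_algebra.
From mathcomp Require Import ring zify.
Import GRing.Theory.
Local Open Scope ring_scope.
Set Implicit Arguments.
Unset Strict Implicit.
Unset Printing Implicit Defensive.

(** * Closures of 3-braid words and invariants under regular isotopy *)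

(* A letter is a position, [false] for sigma_1 and [true] for sigma_2, and a sign. *)
Notation word := (seq (bool * bool)).
Notation pa := (false, true).
Notation pb := (true, true).
Notation na := (false, false).
Notation nb := (true, false).

Definition word_diagram {T : Type} (w : word) : diagram T :=
  [seq (Cross c.2, nat_of_bool c.1) | c <- w].

Lemma word_diagram_cat T u v :
  word_diagram (u ++ v) = word_diagram u ++ word_diagram v :> diagram T.
Proof. exact: map_cat. Qed.

Definition cups {T : Type} (m : nat) (o : T) : diagram T :=
  [seq (Cup o, i) | i <- iota 0 m].
Definition caps {T : Type} (m : nat) : diagram T :=
  [seq (Cap, i) | i <- rev (iota 0 m)].

Definition closure3 {T : Type} (o : T) (w : word) : diagram T :=
  cups 3 o ++ word_diagram w ++ caps 3.

Definition first_diagram {T : Type} (w : seq bool) : diagram T :=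
  [seq (Cross b, 0%N) | b <- w].

Definition closure2 {T : Type} (o : T) (w : seq bool) : diagram T :=
  cups 2 o ++ first_diagram w ++ caps 2.

Definition on_first (w : seq bool) : word := [seq (false, b) | b <- w].

(** These relations present B_3, so [f] is a function on the group; the versions of the braid
    relation with inverse letters follow from the positive one. *)
Definition braid_invariant (R : Type) (f : word -> R) : Prop :=
  (forall u v i b, f (u ++ (i, b) :: (i, ~~ b) :: v) = f (u ++ v)) /\
  (forall u v i,
     f (u ++ (i, true) :: (~~ i, true) :: (i, true) :: v) =
     f (u ++ (~~ i, true) :: (i, true) :: (~~ i, true) :: v)).

Definition cyclic_invariant (R : Type) (f : word -> R) : Prop :=
  forall u v, f (u ++ v) = f (v ++ u).

Ltac run_labels := by do 6 rewrite /run /= ?eqxx.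

Section RegularInvariant.
Variables (T : eqType) (dual : T -> T) (R : Type) (f : diagram T -> R).
Hypothesis f_inv : regular_invariant dual f.

Lemma run_cat s (D D' : diagram T) :
  run dual s (D ++ D') = obind (run dual ^~ D') (run dual s D).
Proof.
rewrite /run foldl_cat; case: (foldl _ _ D) => //=.
by elim: D'.
Qed.

(* [D] and [D'] are interchangeable inside any link diagram in which the strand
   labels are [s] below and [s'] above. *)
Definition diagram_eq (s s' : seq T) (D D' : diagram T) : Prop :=
  [/\ run dual s D = Some s', run dual s D' = Some s' &
      forall u v, run dual [::] u = Some s -> run dual s' v = Some [::] ->
      f (u ++ D ++ v) = f (u ++ D' ++ v)].

Lemma diagram_eq_move s s' u D D' v :
  move D D' -> run dual s (u ++ D ++ v) = Some s' ->
  run dual s (u ++ D' ++ v) = Some s' ->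
  diagram_eq s s' (u ++ D ++ v) (u ++ D' ++ v).
Proof.
move=> mv r r'; split=> // u' v' ru rv.
have E X : u' ++ (u ++ X ++ v) ++ v' = (u' ++ u) ++ X ++ (v ++ v').
  by rewrite !catA.
rewrite !E; apply: f_inv mv _ _; rewrite /link_diagram -E !run_cat ru /=.
  by move: r; rewrite !run_cat => -> /=; rewrite rv.
by move: r'; rewrite !run_cat => -> /=; rewrite rv.
Qed.

Lemma diagram_eq_refl s s' D : run dual s D = Some s' -> diagram_eq s s' D D.
Proof. by split. Qed.

Lemma diagram_eq_sym s s' D D' : diagram_eq s s' D D' -> diagram_eq s s' D' D.
Proof. by case=> r r' e; split=> // u v ru rv; rewrite e. Qed.

Lemma diagram_eq_trans s s' D1 D2 D3 :
  diagram_eq s s' D1 D2 -> diagram_eq s s' D2 D3 -> diagram_eq s s' D1 D3.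
Proof.
by case=> r1 r2 e [_ r3 e']; split=> // u v ru rv; rewrite e // e'.
Qed.

Lemma diagram_eq_cat s s' s'' D1 D1' D2 D2' :
  diagram_eq s s' D1 D1' -> diagram_eq s' s'' D2 D2' ->
  diagram_eq s s'' (D1 ++ D2) (D1' ++ D2').
Proof.
case=> r1 r1' e1 [r2 r2' e2].
split; rewrite ?run_cat ?r1 ?r1' //= => u v ru rv.
rewrite -!catA e1 ?run_cat ?r2 //= !(catA u D1') e2 ?run_cat ?ru //.
Qed.

Lemma diagram_eq_link D D' : diagram_eq [::] [::] D D' -> f D = f D'.
Proof. by case=> _ _ /(_ [::] [::]); rewrite !cats0; apply. Qed.

Variable o : T.
Let S3 := [:: o; o; o; dual o; dual o; dual o].

Lemma run_cups3 : run dual [::] (cups 3 o) = Some S3.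
Proof. by []. Qed.

Lemma run_caps3 : run dual S3 (caps 3) = Some [::].
Proof. run_labels. Qed.

Lemma run_word w : run dual S3 (word_diagram w) = Some S3.
Proof. by elim: w => [|[[] b] w IH] //; exact: IH. Qed.

(** The diagrams [P] and [Q] below and above the word are left arbitrary because one of them will
    also contain a turnback. *)
Lemma context_invariant P Q :
  run dual [::] P = Some S3 -> run dual S3 Q = Some [::] ->
  braid_invariant (fun w => f (P ++ word_diagram w ++ Q)).
Proof.
move=> rP rQ.
have ctx u v D D' : diagram_eq S3 S3 D D' ->
    f (P ++ (word_diagram u ++ D ++ word_diagram v) ++ Q) =
    f (P ++ (word_diagram u ++ D' ++ word_diagram v) ++ Q).
  case=> _ _ e; rewrite -!catA !(catA P).
  by apply: e; rewrite run_cat ?rP /= ?run_word.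
split=> u v i => [b|].
  rewrite -[(i, b) :: _]/([:: (i, b); (i, ~~ b)] ++ v) !word_diagram_cat.
  apply: (ctx _ _ _ [::]).
  by apply: (@diagram_eq_move _ _ [::] _ _ [::] (move_R2 _ b i)); case: i.
rewrite -[_ :: _ :: _ :: v]/([:: (i, true); (~~ i, true); (i, true)] ++ v).
rewrite -[(~~ i, true) :: _ :: _ :: v]/
  ([:: (~~ i, true); (i, true); (~~ i, true)] ++ v).
rewrite !word_diagram_cat; apply: (ctx).
case: i; first apply: diagram_eq_sym;
  exact: (@diagram_eq_move _ _ [::] _ _ [::] (move_R3 _ true 0)).
Qed.

Lemma closure3_invariant : braid_invariant (fun w => f (closure3 o w)).
Proof. exact: context_invariant run_cups3 run_caps3. Qed.


Ltac slide u v m :=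
  refine (diagram_eq_trans (@diagram_eq_move _ _ u _ _ v m _ _) _);
  [run_labels | run_labels |].

Ltac slide_back u v m :=
  refine (diagram_eq_trans (diagram_eq_sym (@diagram_eq_move _ _ u _ _ v m _ _)) _);
  [run_labels | run_labels |].

Notation cup i := (Cup o, i%N : nat).
Notation cap i := (@Cap T, i%N : nat).
Notation crs b i := (@Cross T b, i%N : nat).

(* The strand that closes up position [p] is at position [5 - p], so the crossing
   slides around the extrema to position [4 - p]. *)
Lemma slide_cups p b :
  diagram_eq [::] S3 (cups 3 o ++ word_diagram [:: (p, b)])
    (cups 3 o ++ [:: crs b (4 - p)]).
Proof.
(* Each passage over an extremum flips the bit of the crossing. There are two of them, so [b] on the
   right is written as its double negation. *)
rewrite -{2}[b]negbK; case: p.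
  slide [:: cup 0; cup 1] (Nil (event T)) (move_slide_cup o b 1).
  slide [:: cup 0] [:: crs (~~ b) 2] (@move_far _ (Cup o) (Cup o) 1 1 isT).
  slide [:: cup 0; cup 1] (Nil (event T)) (move_slide_cup o (~~ b) 2).
  exact: diagram_eq_refl.
slide [:: cup 0; cup 1] (Nil (event T)) (@move_far _ (Cup o) (@Cross T b) 2 0 isT).
slide [:: cup 0] [:: cup 2] (move_slide_cup o b 0).
slide (Nil (event T)) [:: crs (~~ b) 1; cup 2] (@move_far _ (Cup o) (Cup o) 0 0 isT).
slide [:: cup 0] [:: cup 2] (move_slide_cup o (~~ b) 1).
slide [:: cup 0; cup 1] (Nil (event T)) (@move_far _ (@Cross T (~~ ~~ b)) (Cup o) 2 2 isT).
exact: diagram_eq_refl.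
Qed.

Lemma slide_caps p b :
  diagram_eq S3 [::] (word_diagram [:: (p, b)] ++ caps 3)
    (crs b (4 - p) :: caps 3).
Proof.
rewrite -{2}[b]negbK; case: p.
  slide (Nil (event T)) [:: cap 1; cap 0] (@move_slide_cap T b 1).
  slide_back [:: crs (~~ b) 2] [:: cap 0] (@move_far _ (@Cap T) (@Cap T) 3 1 isT).
  slide (Nil (event T)) [:: cap 1; cap 0] (@move_slide_cap T (~~ b) 2).
  by apply: diagram_eq_refl; run_labels.
slide_back (Nil (event T)) [:: cap 1; cap 0] (@move_far _ (@Cap T) (@Cross T b) 2 0 isT).
slide [:: cap 2] [:: cap 0] (@move_slide_cap T b 0).
slide_back [:: cap 2; crs (~~ b) 1] (Nil (event T)) (@move_far _ (@Cap T) (@Cap T) 2 0 isT).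
slide [:: cap 2] [:: cap 0] (@move_slide_cap T (~~ b) 1).
slide_back (Nil (event T)) [:: cap 1; cap 0] (@move_far _ (@Cross T (~~ ~~ b)) (@Cap T) 4 2 isT).
by apply: diagram_eq_refl; run_labels.
Qed.

(** The closing strands are disjoint from the braid strands, so the exchange of distant events
    applies letter by letter. *)
Lemma slide_word (p b : bool) w :
  diagram_eq S3 S3 (crs b (4 - p) :: word_diagram w)
    (word_diagram w ++ [:: crs b (4 - p)]).
Proof.
elim: w => [|[p' b'] w IH]; first by apply: diagram_eq_refl; case: p.
apply: (@diagram_eq_trans _ _ _ ([:: crs b' p'; crs b (4 - p)] ++ word_diagram w)).
  apply: (@diagram_eq_cat _ S3 _ [:: crs b (4 - p); crs b' p']); last first.
    by apply: diagram_eq_refl; rewrite run_word.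
  have le : (p' + width_in (@Cross T b') <= 4 - p)%N by clear; case: p; case: p'.
  have := @diagram_eq_move S3 S3 [::] _ _ [::]
    (@move_far _ (@Cross T b) (@Cross T b') _ _ le).
  by rewrite /= addnK; apply; clear; case: p; case: p'.
apply: (@diagram_eq_cat _ S3 _ [:: crs b' p'] [:: crs b' p']) IH.
by apply: diagram_eq_refl; case: p'.
Qed.

(** The bottom letter slides around the cups to the closing strands, travels up past the rest of the
    word and returns around the caps at the top. *)
Lemma closure3_cyclic : cyclic_invariant (fun w => f (closure3 o w)).
Proof.
have rot1 x w : f (closure3 o (x :: w)) = f (closure3 o (w ++ [:: x])).
  case: x => p b; apply: diagram_eq_link.
  apply: (@diagram_eq_trans _ _ _
    (cups 3 o ++ (crs b (4 - p) :: word_diagram w) ++ caps 3)).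
    rewrite -[_ :: _]cat1s (catA (cups 3 o)) -!catA.
    rewrite /closure3 -cat1s word_diagram_cat -!catA !(catA (cups 3 o)).
    apply: diagram_eq_cat (slide_cups p b) (diagram_eq_refl _).
    by rewrite run_cat run_word /= run_caps3.
  apply: (@diagram_eq_trans _ _ _
    (cups 3 o ++ (word_diagram w ++ [:: crs b (4 - p)]) ++ caps 3)).
    apply: diagram_eq_cat (diagram_eq_refl run_cups3) _.
    exact: diagram_eq_cat (slide_word p b w) (diagram_eq_refl run_caps3).
  rewrite /closure3 word_diagram_cat -!catA.
  apply: diagram_eq_cat (diagram_eq_refl run_cups3) _.
  apply: diagram_eq_cat (diagram_eq_refl (run_word w)) _.
  exact: diagram_eq_sym (slide_caps p b).
elim=> [|x u IH] v; first by rewrite cats0.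
by rewrite cat_cons rot1 -catA IH -catA.
Qed.

(** The four letters take the neighbouring strand once around both legs of the new cup, which is
    pulled off it by two moves of type II. *)
Lemma cup_around_strand (p : bool) x y z t :
  diagram_eq [:: x; y; z; t]
    (if p then [:: x; o; dual o; y; z; t] else [:: o; dual o; x; y; z; t])
    (cup p :: word_diagram [:: (~~ p, true); (p, true); (p, true); (~~ p, true)])
    [:: cup p].
Proof.
case: p.
  slide (Nil (event T)) [:: crs true 1; crs true 1; crs true 0]
    (move_slide_cup o true 0).
  slide [:: cup 0] [:: crs true 1; crs true 0] (@move_R2 T false 1).
  slide_back (Nil (event T)) [:: crs true 0] (move_slide_cup o false 0).
  slide [:: cup 1] (Nil (event T)) (@move_R2 T false 0).
  exact: diagram_eq_refl.
slide_back (Nil (event T)) [:: crs true 0; crs true 0; crs true 1]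
  (move_slide_cup o false 0).
slide [:: cup 1] [:: crs true 0; crs true 1] (@move_R2 T false 0).
slide (Nil (event T)) [:: crs true 1] (move_slide_cup o true 0).
slide [:: cup 0] (Nil (event T)) (@move_R2 T false 1).
exact: diagram_eq_refl.
Qed.

Let S2 := [:: o; o; dual o; dual o].

Lemma run_first w : run dual S2 (first_diagram w) = Some S2.
Proof. by elim: w => [|b w IH] //; exact: IH. Qed.

Lemma word_diagram_on_first w :
  word_diagram (on_first w) = first_diagram w :> diagram T.
Proof. by rewrite /word_diagram -map_comp. Qed.

Lemma run_first3 w : run dual S3 (first_diagram w) = Some S3.
Proof. by rewrite -word_diagram_on_first run_word. Qed.

Lemma slide_third_cup w :
  diagram_eq S2 S3 (cup 2 :: first_diagram w) (first_diagram w ++ [:: cup 2]).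
Proof.
elim: w => [|b w IH]; first exact: diagram_eq_refl.
apply: (@diagram_eq_trans _ _ _ ([:: crs b 0; cup 2] ++ first_diagram w)).
  apply: (@diagram_eq_cat _ S3 _ [:: cup 2; crs b 0]); last first.
    by apply: diagram_eq_refl; exact: run_first3.
  exact: (@diagram_eq_move S2 S3 [::] _ _ [::]
    (@move_far _ (Cup o) (@Cross T b) 2 0 isT)).
exact: (@diagram_eq_cat _ S2 _ [:: crs b 0] [:: crs b 0] _ _ (diagram_eq_refl _) IH).
Qed.

(** The crossings of [on_first w] do not touch the third strand, so its cup can wait until just
    before [D], where it can form a curl or a zigzag. *)
Lemma closure3_third_cup w D :
  run dual S3 D = Some S2 ->
  f (cups 3 o ++ word_diagram (on_first w) ++ D ++ caps 2) =
  f (cups 2 o ++ first_diagram w ++ (cup 2 :: D) ++ caps 2).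
Proof.
move=> rD; apply: diagram_eq_link.
have r2 : run dual S2 (caps 2) = Some [::] by run_labels.
rewrite word_diagram_on_first.
have := @diagram_eq_cat [::] S2 [::] (cups 2 o) (cups 2 o)
  (cup 2 :: first_diagram w ++ D ++ caps 2)
  (first_diagram w ++ (cup 2 :: D) ++ caps 2); apply.
  exact: diagram_eq_refl.
have -> : first_diagram w ++ (cup 2 :: D) ++ caps 2 =
    (first_diagram w ++ [:: cup 2]) ++ D ++ caps 2 by rewrite -catA.
apply: (@diagram_eq_cat _ S3 _ (cup 2 :: first_diagram w)) (slide_third_cup w) _.
by apply: diagram_eq_refl; rewrite run_cat rD.
Qed.

End RegularInvariant.

(** * Markov stabilisation for closures *)

Section Markov.
Variables (T : eqType) (dual : T -> T) (F : fieldType) (c : F).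
Variables (f : diagram T -> F) (o : T).
Hypotheses (f_inv : regular_invariant dual f) (f_curl : curl_factor dual c f).

Lemma link_closure2 w : link_diagram dual (closure2 o w).
Proof.
rewrite /link_diagram /closure2 run_cat /= run_cat run_first /=.
by apply/eqP; run_labels.
Qed.

(** Once the third cup is raised past [on_first w], the last letter lies between this cup and the
    third cap, and the three events form a curl. *)
Lemma closure3_markov w b :
  f (closure3 o (on_first w ++ [:: (true, b)])) =
  (if b then c else c^-1) * f (closure2 o w).
Proof.
have e : closure3 o (on_first w ++ [:: (true, b)]) =
    cups 3 o ++ word_diagram (on_first w) ++ [:: (Cross b, 1); (Cap, 2)]%N ++ caps 2.
  by rewrite /closure3 word_diagram_cat -catA.
rewrite e (closure3_third_cup f_inv); last by run_labels.
have := f_curl (u := cups 2 o ++ first_diagram w) (v := caps 2)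
  (curl_right dual o b 1).
have E D : (cups 2 o ++ first_diagram w) ++ D = cups 2 o ++ first_diagram w ++ D.
  by rewrite -catA.
rewrite !E; apply; last exact: link_closure2.
rewrite /link_diagram run_cat /= run_cat run_first /=.
by apply/eqP; run_labels.
Qed.

Lemma closure2_markov b :
  f (closure2 o [:: b]) =
  (if b then c else c^-1) * f [:: (Cup o, 0); (Cap, 0)]%N.
Proof.
apply: (f_curl (u := [:: (Cup o, 0%N)]) (v := [:: (Cap, 0%N)])
  (curl_right dual o b 0)).
  exact: (link_closure2 [:: b]).
by apply/eqP; run_labels.
Qed.

End Markov.

(** * Braid words *)

(** Equality in B_3, encoded as indistinguishability by all braid invariants in all contexts; this
    makes it a congruence at once. *)
Definition braid_eq (w w' : word) : Prop :=
  forall (R : Type) (g : word -> R), braid_invariant g ->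
  forall u v, g (u ++ w ++ v) = g (u ++ w' ++ v).

Lemma braid_eq_refl w : braid_eq w w. Proof. by []. Qed.

Lemma braid_eq_sym w w' : braid_eq w w' -> braid_eq w' w.
Proof. by move=> e R g gi u v; rewrite e. Qed.

Lemma braid_eq_trans w1 w2 w3 :
  braid_eq w1 w2 -> braid_eq w2 w3 -> braid_eq w1 w3.
Proof. by move=> e e' R g gi u v; rewrite e // e'. Qed.

Lemma braid_eq_cat w1 w1' w2 w2' :
  braid_eq w1 w1' -> braid_eq w2 w2' -> braid_eq (w1 ++ w2) (w1' ++ w2').
Proof. by move=> e e' R g gi u v; rewrite -!catA e // catA e' // -catA. Qed.

Lemma braid_eqE (R : Type) (g : word -> R) w w' :
  braid_invariant g -> braid_eq w w' -> g w = g w'.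
Proof. by move=> gi /(_ _ _ gi [::] [::]); rewrite !cats0. Qed.

Lemma braid_eq_cancel i b : braid_eq [:: (i, b); (i, ~~ b)] [::].
Proof. by move=> R g [R2 _] u v; rewrite R2. Qed.

Lemma braid_eq_R3 u v i :
  braid_eq (u ++ (i, true) :: (~~ i, true) :: (i, true) :: v)
    (u ++ (~~ i, true) :: (i, true) :: (~~ i, true) :: v).
Proof. by move=> R g [_ R3] u' v'; rewrite -!catA !(catA u') /= R3. Qed.

Definition winv (w : word) : word := rev [seq (c.1, ~~ c.2) | c <- w].

Lemma winvV w : braid_eq (winv w ++ w) [::].
Proof.
elim: w => // -[i b] w IH; rewrite /winv map_cons rev_cons -cats1 -catA.
apply: (@braid_eq_trans _ (winv w ++ [::] ++ w)); last exact: IH.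
apply: braid_eq_cat => //; rewrite -(cat1s (i, b) w) catA.
apply: braid_eq_cat => //; by have := braid_eq_cancel i (~~ b); rewrite negbK.
Qed.

Definition wexp (w : word) (n : int) : word :=
  match n with
  | Posz m => flatten (nseq m w)
  | Negz m => flatten (nseq m.+1 (winv w))
  end.

Lemma flatten_nseqSr (A : Type) (w : seq A) m :
  flatten (nseq m.+1 w) = flatten (nseq m w) ++ w.
Proof. by elim: m => [|m IH]; rewrite /= ?cats0 // -catA -IH. Qed.

Lemma wexpS w n : braid_eq (wexp w (n + 1)) (wexp w n ++ w).
Proof.
case: n => [m|[|m]].
- by rewrite -PoszD addn1 /wexp flatten_nseqSr.
- by apply: braid_eq_sym; rewrite /= cats0; apply: winvV.
have -> : Negz m.+1 + 1 = Negz m by rewrite !NegzE; lia.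
rewrite {2}/wexp flatten_nseqSr -catA -[X in braid_eq X]cats0.
apply: braid_eq_cat => //; apply: braid_eq_sym; exact: winvV.
Qed.

Definition full_twist : word := [:: pb; pa; pb; pa; pb; pa].

Ltac braid_step u v i := refine (braid_eq_trans (braid_eq_R3 u v i) _).

Lemma full_twistE1 i :
  braid_eq full_twist [:: (i, true); (~~ i, true); (i, true); (~~ i, true);
    (i, true); (~~ i, true)].
Proof.
case: i => //; braid_step (Nil (bool * bool)) [:: pa; pb; pa] true.
by braid_step [:: pa; pb; pa] (Nil (bool * bool)) false.
Qed.

(** The two leading equal letters will become curls on a cup at [i], and the other four are the word
    of [cup_around_strand]. *)
Lemma full_twistE2 i :
  braid_eq full_twist [:: (i, true); (i, true); (~~ i, true); (i, true);
    (i, true); (~~ i, true)].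
Proof.
apply: braid_eq_trans (full_twistE1 i) _.
by case: i; [braid_step [:: pb] [:: pb; pa] false
            | braid_step [:: pa] [:: pa; pb] true].
Qed.

(** For [i = false] the first four letters spell [E3], which gives F_3 = E_3 sigma_2^2; [i = true]
    is the form used in [full_twist_cancel]. *)
Lemma full_twistE3 i :
  braid_eq full_twist [:: (i, true); (~~ i, true); (~~ i, true); (i, true);
    (~~ i, true); (~~ i, true)].
Proof.
apply: braid_eq_trans (full_twistE1 i) _.
by case: i; [braid_step [:: pb; pa] [:: pa] true
            | braid_step [:: pa; pb] [:: pb] false].
Qed.

(** Appending [i] to the alternating word that starts with [i] gives [i] followed by the alternating
    word that starts with the other letter, which is again a full twist. *)
Lemma full_twist_central w : braid_eq (full_twist ++ w) (w ++ full_twist).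
Proof.
have pos i : braid_eq (full_twist ++ [:: (i, true)]) ([:: (i, true)] ++ full_twist).
  apply: braid_eq_trans (braid_eq_cat (full_twistE1 i) (@braid_eq_refl _)) _.
  apply: braid_eq_cat (@braid_eq_refl [:: (i, true)]) _; apply: braid_eq_sym.
  by have := full_twistE1 (~~ i); rewrite negbK.
have letter x : braid_eq (full_twist ++ [:: x]) ([:: x] ++ full_twist).
  (* For an inverse letter, the positive case is multiplied by that letter on both sides. *)
  case: x => i [] //; set x := (i, false).
  have xp : braid_eq [:: x; (i, true)] [::] by apply: (braid_eq_cancel i false).
  have px : braid_eq [:: (i, true); x] [::] by apply: (braid_eq_cancel i true).
  apply: (@braid_eq_trans _ ([:: x] ++ ([:: (i, true)] ++ full_twist) ++ [:: x])).
    by apply: (braid_eq_cat (braid_eq_sym xp)).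
  apply: (@braid_eq_trans _ ([:: x] ++ (full_twist ++ [:: (i, true)]) ++ [:: x])).
    apply: braid_eq_cat => //; apply: braid_eq_cat => //; exact: braid_eq_sym.
  apply: (@braid_eq_cat [:: x]) => //; rewrite -[X in braid_eq _ X]cats0 -catA.
  by apply: braid_eq_cat.
elim: w => [|x w IH]; first by rewrite cats0.
apply: (@braid_eq_trans _ ([:: x] ++ full_twist ++ w)).
  by rewrite -(cat1s x w) !catA; apply: braid_eq_cat.
exact: (@braid_eq_cat [:: x] [:: x] _ _ (@braid_eq_refl _) IH).
Qed.

Definition writhe_word (w : word) : int := \sum_(c <- w) (if c.2 then 1 else -1).

Lemma writhe_word_cat u v : writhe_word (u ++ v) = writhe_word u + writhe_word v.
Proof. exact: big_cat. Qed.

Lemma writhe_word_cons i b w :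
  writhe_word ((i, b) :: w) = (if b then 1 else -1) + writhe_word w.
Proof. exact: big_cons. Qed.

Lemma writhe_word_nil : writhe_word [::] = 0.
Proof. exact: big_nil. Qed.

Lemma writhe_word_invariant : braid_invariant writhe_word.
Proof.
split=> u v i => [b|]; rewrite !writhe_word_cat !writhe_word_cons //.
by case: b => /=; ring.
Qed.

Lemma writhe_word_cyclic : cyclic_invariant writhe_word.
Proof. by move=> u v; rewrite !writhe_word_cat addrC. Qed.

Lemma writhe_word_full_twist : writhe_word full_twist = 6.
Proof. by rewrite !writhe_word_cons writhe_word_nil. Qed.

(** * Traces on the Hecke algebra of B_3 *)

Section Functionals.
Variables (F : fieldType).
Implicit Types (g : word -> F) (z c : F).

Lemma twist_invariant c g :
  braid_invariant g -> braid_invariant (fun w => c ^ writhe_word w * g w).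
Proof.
move=> [R2 R3]; case: writhe_word_invariant => w2 w3.
by split=> *; rewrite ?w2 ?R2 ?w3 ?R3.
Qed.

Lemma twist_cyclic c g :
  cyclic_invariant g -> cyclic_invariant (fun w => c ^ writhe_word w * g w).
Proof. by move=> gc u v; rewrite gc writhe_word_cyclic. Qed.

Lemma shift_invariant g : braid_invariant g ->
  braid_invariant (fun w => g (w ++ full_twist)).
Proof. by move=> [R2 R3]; split=> *; rewrite -!catA /= ?R2 ?R3. Qed.

Lemma shift_cyclic g : braid_invariant g -> cyclic_invariant g ->
  cyclic_invariant (fun w => g (w ++ full_twist)).
Proof.
move=> gi gc u v; have := full_twist_central u gi v [::].
rewrite !cats0 => e; by rewrite -catA gc -catA e catA.
Qed.

Lemma braid_invariant_lin c c' g g' : braid_invariant g -> braid_invariant g' ->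
  braid_invariant (fun w => c * g w + c' * g' w).
Proof. by case=> R2 R3 [R2' R3']; split=> *; rewrite ?R2 ?R2' ?R3 ?R3'. Qed.

(** The condition for [g] to extend to a linear functional on the Hecke algebra, where sigma_i -
    sigma_i^-1 = z. *)
Definition hecke z g : Prop :=
  braid_invariant g /\
  forall u v i, g (u ++ (i, true) :: v) - g (u ++ (i, false) :: v) = z * g (u ++ v).

Definition hecke_trace z g : Prop := hecke z g /\ cyclic_invariant g.

Lemma hecke_trace_lin z c c' g g' : hecke_trace z g -> hecke_trace z g' ->
  hecke_trace z (fun w => c * g w + c' * g' w).
Proof.
case=> [[gi sk] cy] [[gi' sk'] cy'].
split; first split; first exact: braid_invariant_lin.
  move=> u v i; have := sk' u v i; have := sk u v i => e e'.
  transitivity (c * (z * g (u ++ v)) + c' * (z * g' (u ++ v))); last by ring.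
  by rewrite -e -e'; ring.
by move=> u v; rewrite cy cy'.
Qed.

Lemma hecke_trace_shift z g : hecke_trace z g ->
  hecke_trace z (fun w => g (w ++ full_twist)).
Proof.
case=> [[gi sk] cy]; split; last exact: shift_cyclic.
split; first exact: shift_invariant.
by move=> u v i; rewrite -!catA /= sk.
Qed.

Section Skein.
Variables (z : F) (g : word -> F).
Hypothesis gH : hecke z g.

Lemma hecke_sq u v i :
  g (u ++ (i, true) :: (i, true) :: v) = z * g (u ++ (i, true) :: v) + g (u ++ v).
Proof.
case: gH => [[R2 _] sk]; have := sk (u ++ [:: (i, true)]) v i.
by rewrite -!catA /= (R2 _ _ i true) => /eqP; rewrite subr_eq => /eqP.
Qed.

Lemma hecke_neg u v i :
  g (u ++ (i, false) :: v) = g (u ++ (i, true) :: v) - z * g (u ++ v).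
Proof. by case: gH => _ /(_ u v i) <-; ring. Qed.

End Skein.

(* The six words span the Hecke algebra of type A_2. *)
Lemma hecke_eq0 z g : hecke z g ->
  g [::] = 0 -> g [:: pa] = 0 -> g [:: pb] = 0 -> g [:: pa; pb] = 0 ->
  g [:: pb; pa] = 0 -> g [:: pa; pb; pa] = 0 -> forall w, g w = 0.
Proof.
move=> gH g0 ga gb gab gba gaba w.
(* The functional is generalised: prefixing a positive letter turns [g] into another Hecke
   functional that vanishes on the six words. *)
elim: w g gH g0 ga gb gab gba gaba => // -[i s] w IH g gH g0 ga gb gab gba gaba.
case: (gH) => [[R2 R3] sk].
have gbab : g [:: pb; pa; pb] = 0 by rewrite (R3 [::] [::] true).
have left x : hecke z (fun w => g (x :: w)).
  split=> [|u v j]; last by rewrite (sk (x :: u)).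
  by split=> u v j *; [rewrite (R2 (x :: u)) | rewrite (R3 (x :: u))].
have sq i' v : g ((i', true) :: (i', true) :: v) = z * g ((i', true) :: v) + g v
  by rewrite (hecke_sq gH [::]).
have pos : g ((i, true) :: w) = 0.
  case: i; (apply: (IH _ (left _)) => //;
    rewrite ?sq ?g0 ?ga ?gb ?gab ?gba ?gaba ?gbab ?mulr0 ?addr0 //).
  rewrite (R3 [::] [:: pa] true) /= (hecke_sq gH [:: pa; pb] [::] false).
  by rewrite gaba gab mulr0 addr0.
case: s => //; rewrite (hecke_neg gH [::]) /= pos (IH g gH) //.
by rewrite mulr0 subr0.
Qed.

(** By the braid relation, sigma_1 and sigma_2 are conjugate in B_3. *)
Lemma hecke_trace_ab z g : hecke_trace z g -> g [:: pb] = g [:: pa].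
Proof.
case=> [[gi sk] cy]; have [R2 R3] := gi.
rewrite -(R2 [:: pb] [::] false true) /= -(R2 [:: pb; pa] [:: na] true true) /=.
rewrite (R3 [::] [:: nb; na] true) /= (cy [:: pa] [:: pb; pa; nb; na]) /=.
rewrite (R2 [:: pb; pa; nb] [::] false false) /= (cy [:: pb; pa] [:: nb]) /=.
by rewrite (R2 [::] [:: pa] true false).
Qed.

(** One word for each conjugacy class of S_3 is enough: cyclic rotation and the quadratic relation
    reduce the six basis words to these three. *)
Lemma hecke_trace_eq0 z g : hecke_trace z g ->
  g [::] = 0 -> g [:: pa] = 0 -> g [:: pa; pb] = 0 -> forall w, g w = 0.
Proof.
move=> gT g0 ga gab; have gb : g [:: pb] = 0 by rewrite (hecke_trace_ab gT).
case: (gT) => gH cy; apply: (hecke_eq0 gH) => //.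
  by rewrite (cy [:: pb] [:: pa]).
rewrite (cy [:: pa; pb] [:: pa]) /= (hecke_sq gH [::]) /=.
by rewrite gab gb mulr0 addr0.
Qed.

(** These test words are chosen for [full_twist_cancel]: followed by the full twist they reduce to
    short positive words, so shifted functionals can be evaluated on them. *)
Lemma hecke_trace_eq0_neg z g : hecke_trace z g ->
  g [:: na; na] = 0 -> g [:: na; nb] = 0 -> g [:: na; na; nb] = 0 ->
  forall w, g w = 0.
Proof.
move=> gT gaa gab gaab; case: (gT) => gH cy; case: (gH) => [[R2 _] sk].
have gnb : g [:: nb] = 0.
  have := sk [:: na] [:: nb] false.
  by rewrite /= (R2 [::] _ false false) gaab gab subr0 mulr0.
have gb : g [:: pb] = z * g [::].
  by apply/eqP; rewrite -subr_eq0 -(hecke_neg gH [::] [::] true) gnb.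
have ga := hecke_trace_ab gT; rewrite gb in ga.
have gna : g [:: na] = 0 by rewrite (hecke_neg gH [::] [::] false) /= -ga subrr.
have g0 : g [::] = 0.
  have := sk [:: na] [::] false.
  by rewrite /= (R2 [::] _ false false) gaa gna mulr0 subr0.
apply: (hecke_trace_eq0 gT g0); first by rewrite -ga g0 mulr0.
have := sk [:: pa] [::] true; have := sk [::] [:: nb] false.
by rewrite /= gab gnb -ga g0 !mulr0 subr0 => -> /eqP; rewrite subr0 => /eqP.
Qed.
End Functionals.

(** * The braids of the family *)

Definition family_word (neg : bool) (j k l : int) : word :=
  [:: pa] ++ wexp [:: pb] ((-1) ^+ neg * (1 + 2 * j)) ++ wexp full_twist l ++
  wexp [:: pa; pb; pb; pa] k.

Definition normal_word (n p : int) : word :=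
  [:: pa] ++ wexp [:: pb] n ++ wexp full_twist p.

Lemma int_bi_ind (P : int -> Prop) :
  P 0 -> (forall n, P n <-> P (n + 1)) -> forall n, P n.
Proof.
move=> P0 PS; elim=> [|n IH|n IH] //; first by rewrite -addn1 PoszD -PS.
by rewrite PS; have -> : - n.+1%:Z + 1 = - n%:Z by lia.
Qed.

Lemma winvK w : winv (winv w) = w.
Proof.
rewrite /winv map_rev revK -map_comp -[RHS]map_id.
by apply: eq_map => -[i b] /=; rewrite negbK.
Qed.

#[local] Instance braid_eq_equiv : Equivalence braid_eq.
Proof.
by split=> [w | w w' | w1 w2 w3];
  [exact: braid_eq_refl | exact: braid_eq_sym | exact: braid_eq_trans].
Qed.

#[local] Instance cat_proper : Proper (braid_eq ==> braid_eq ==> braid_eq) (@cat _).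
Proof. by move=> u u' eu v v' ev; apply: braid_eq_cat. Qed.

Lemma braid_eq_cancelr w u v : braid_eq (u ++ w) (v ++ w) <-> braid_eq u v.
Proof.
split=> [e|-> //]; have ww : braid_eq (w ++ winv w) [::].
  by have := winvV (winv w); rewrite winvK.
by rewrite -(cats0 u) -(cats0 v) -ww !catA e.
Qed.

Lemma wexpB i n :
  braid_eq (wexp [:: (i, true)] (n - 1)) (wexp [:: (i, true)] n ++ [:: (i, false)]).
Proof.
rewrite -[n in X in braid_eq _ X](subrK 1) wexpS -catA -{1}(cats0 (wexp _ _)).
by apply: braid_eq_cat => //; apply: braid_eq_sym; apply: (braid_eq_cancel i true).
Qed.

Lemma wexp_full_twist_central p w :
  braid_eq (wexp full_twist p ++ w) (w ++ wexp full_twist p).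
Proof.
elim/int_bi_ind: p => [|p]; first by rewrite /= cats0.
rewrite -(braid_eq_cancelr full_twist (wexp _ p ++ _)) -!catA.
by rewrite -(full_twist_central w) !wexpS -!catA.
Qed.

Lemma normal_wordE n l k :
  braid_eq ([:: pa] ++ wexp [:: pb] n ++ wexp full_twist l ++
      wexp [:: pa; pb; pb; pa] k)
    (normal_word (n - 2 * k) (l + k)).
Proof.
apply: (@braid_eq_cat [:: pa]) => //; set E := [:: pa; pb; pb; pa].
have EE : braid_eq (E ++ [:: pb; pb]) full_twist by rewrite (full_twistE3 false).
elim/int_bi_ind: k => [|k]; first by rewrite /= mulr0 subr0 addr0 cats0.
(* Since E sigma_2^2 is a full twist, multiplying the claim for [k] by the full twist and the claim
   for [k + 1] by sigma_2^2 makes the two claims coincide. *)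
rewrite -(braid_eq_cancelr full_twist (_ ++ _ ++ wexp E k)).
rewrite -(braid_eq_cancelr [:: pb; pb] (_ ++ _ ++ wexp E (k + 1))).
have -> : n - 2 * k = n - 2 * (k + 1) + 1 + 1 by ring.
rewrite addrA !wexpS -!catA EE.
rewrite (full_twist_central [:: pb; pb]) (catA (wexp full_twist (l + k))).
by rewrite (wexp_full_twist_central (l + k) [:: pb; pb]) -!catA.
Qed.

Lemma family_wordE neg j k l : braid_eq (family_word neg j k l)
  (normal_word ((-1) ^+ neg * (1 + 2 * j) - 2 * k) (l + k)).
Proof. exact: normal_wordE. Qed.

Lemma family_exponent_odd (neg : bool) (j k : int) :
  exists m : int, (-1) ^+ neg * (1 + 2 * j) - 2 * k = 1 + 2 * m.
Proof.
exists (if neg then - (1 + j) - k else j - k).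
by case: neg => /=; rewrite ?expr0 ?expr1; ring.
Qed.

Definition word_braid (w : word) : braid := [seq (nat_of_bool c.1, c.2) | c <- w].

Lemma word_braid_cat u v : word_braid (u ++ v) = word_braid u ++ word_braid v.
Proof. exact: map_cat. Qed.

Lemma word_braid_exp w n : word_braid (wexp w n) = bexp (word_braid w) n.
Proof.
have E m v : word_braid (flatten (nseq m v)) = flatten (nseq m (word_braid v)).
  by elim: m => //= m IH; rewrite word_braid_cat IH.
case: n => m; rewrite /= ?E // -/(flatten (nseq m.+1 _)) word_braid_cat E.
have -> // : word_braid (winv w) = binv (word_braid w).
by rewrite /word_braid /winv /binv map_rev -!map_comp.
Qed.

Lemma Kjkl_word neg j k l : Kjkl neg j k l = word_braid (family_word neg j k l).
Proof. by rewrite /family_word !word_braid_cat !word_braid_exp. Qed.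

Lemma braid_closure_word w : braid_closure 3 (word_braid w) = closure3 true w.
Proof. by rewrite /braid_closure /closure3 /word_diagram -map_comp. Qed.

Lemma erase_closure w : erase (closure3 true w) = closure3 tt w.
Proof.
rewrite /erase /closure3 !map_cat -!map_comp; congr (_ ++ (_ ++ _)).
Qed.

Lemma writhe_closure w : writhe (closure3 true w) = writhe_word w.
Proof.
rewrite /writhe /closure3 /= !add0r.
elim: w => [|[[] b] w IH]; first by rewrite writhe_word_nil.
  by rewrite writhe_word_cons -IH /=; case: b.
by rewrite writhe_word_cons -IH /=; case: b.
Qed.

Lemma writhe_wexp w n : writhe_word (wexp w n) = n * writhe_word w.
Proof.
elim/int_bi_ind: n => [|n]; first by rewrite writhe_word_nil mul0r.
rewrite (braid_eqE writhe_word_invariant (wexpS w n)) writhe_word_cat mulrDl mul1r.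
by split=> [->|/addIr].
Qed.

Lemma writhe_normal_word n p : writhe_word (normal_word n p) = 1 + n + 6 * p.
Proof.
rewrite !writhe_word_cat !writhe_wexp writhe_word_full_twist.
by rewrite !writhe_word_cons writhe_word_nil; ring.
Qed.

(* A solution of a two-term recurrence on the integers is determined by two
   consecutive values. *)
Lemma recurrence_unique (F : fieldType) (c : F) (x y : int -> F) :
  (forall m, x (m + 1) + x (m - 1) = c * x m) ->
  (forall m, y (m + 1) + y (m - 1) = c * y m) ->
  x 0 = y 0 -> x (-1) = y (-1) -> forall m, x m = y m.
Proof.
move=> rx ry e0 e1 m.
suff [] : x m = y m /\ x (m - 1) = y (m - 1) by [].
elim/int_bi_ind: m => [|m]; first by rewrite add0r.
rewrite addrK; have := rx m; have := ry m; set a := x _; set b := y (m + 1).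
move=> eb ea; split=> [[e e']|[e e']]; split=> //.
  by apply: (addIr (x (m - 1))); rewrite ea e e' eb.
by apply: (addrI a); rewrite ea e e' eb.
Qed.

(** * Characters of the Hecke algebra and their weights *)

Section HeckeFormula.
Variables (F : fieldType) (q : F).
Hypothesis q0 : q != 0.
Let z := q - q^-1.

Definition mx2 (a b c d : F) : 'M[F]_2 :=
  \matrix_(i, j) if i == 0 then if j == 0 then a else b else if j == 0 then c else d.

Lemma mx2_mul a b c d a' b' c' d' : mx2 a b c d * mx2 a' b' c' d' =
  mx2 (a * a' + b * c') (a * b' + b * d') (c * a' + d * c') (c * b' + d * d').
Proof.
apply/matrixP => i j; rewrite !mxE big_ord_recl big_ord_recl big_ord0 !mxE addr0 /=.
by case: i => [[|[]]] //; case: j => [[|[]]].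
Qed.

Lemma mx2_trace a b c d : \tr (mx2 a b c d) = a + d.
Proof. by rewrite /mxtrace 2!big_ord_recl big_ord0 !mxE addr0. Qed.

Lemma mx2_1 : mx2 1 0 0 1 = 1.
Proof. by apply/matrixP => -[[|[]] //= ?] -[[|[]] //= ?]; rewrite !mxE. Qed.

(** The reduced Burau representation, normalised so that each generator has eigenvalues q and -q^-1,
    as the Hecke relation requires. *)
Definition burau_letter (c : bool * bool) : 'M[F]_2 :=
  match c with
  | (false, true) => mx2 (- q^-1) q 0 q
  | (true, true) => mx2 q 0 q^-1 (- q^-1)
  | (false, false) => mx2 (- q) q 0 q^-1
  | (true, false) => mx2 q^-1 0 q^-1 (- q)
  end.

Definition burau (w : word) : 'M[F]_2 := \prod_(c <- w) burau_letter c.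

Lemma burau_cat u v : burau (u ++ v) = burau u * burau v.
Proof. exact: big_cat. Qed.

Lemma burau_cons c w : burau (c :: w) = burau_letter c * burau w.
Proof. exact: big_cons. Qed.

Lemma burau_nil : burau [::] = 1. Proof. exact: big_nil. Qed.

Lemma burau_invariant : braid_invariant burau.
Proof.
split=> u v i => [b|]; rewrite !burau_cat !burau_cons; congr (_ * _).
  rewrite mulrA -[RHS]mul1r -mx2_1; congr (_ * _).
  by case: i; case: b; rewrite /= mx2_mul; congr mx2; field.
rewrite !mulrA; congr (_ * _).
by case: i; rewrite /= !mx2_mul; congr mx2; field.
Qed.

Lemma burau_full_twist : burau full_twist = 1.
Proof.
rewrite !burau_cons burau_nil mulr1 /= !mx2_mul -mx2_1.
by congr mx2; field.
Qed.

Lemma burau_wexp_full_twist p : burau (wexp full_twist p) = 1.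
Proof.
elim/int_bi_ind: p => [|p]; first exact: burau_nil.
by rewrite (braid_eqE burau_invariant (wexpS _ _)) burau_cat burau_full_twist mulr1.
Qed.

Lemma hecke_trace_burau : hecke_trace z (fun w => \tr (burau w)).
Proof.
have [R2 R3] := burau_invariant; split; first split; first by split=> *; rewrite ?R2 ?R3.
  move=> u v i; rewrite !burau_cat !burau_cons -mxtraceZ.
  rewrite -raddfB /= -mulrBr -mulrBl; congr (\tr _).
  have -> : burau_letter (i, true) - burau_letter (i, false) = z%:A.
    case: i; apply/matrixP => -[[|[]] //= ?] -[[|[]] //= ?]; rewrite !mxE /z /=; ring.
  by rewrite -scalerAl mul1r -scalerAr.
by move=> u v; rewrite !burau_cat -[LHS]mxtrace_mulC.
Qed.

(** The two roots [q] and [- q^-1] of x - x^-1 = z give the two linear characters. *)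
Lemma hecke_trace_linear_char x : x != 0 -> x - x^-1 = z ->
  hecke_trace z (fun w => x ^ writhe_word w).
Proof.
move=> x0 xz; have [w2 w3] := writhe_word_invariant.
split; first split; first by split=> *; rewrite ?w2 ?w3.
  move=> u v i; rewrite !writhe_word_cat !writhe_word_cons /=.
  by rewrite !(expfzDr _ _ x0) expr1z exprN1 -xz; ring.
by move=> u v; rewrite writhe_word_cyclic.
Qed.

(** The image of sigma_2^2 has eigenvalues q^2 and q^-2, so both sides satisfy the same two-term
    recurrence in [m], started at [0] and [-1]. *)
Lemma burau_trace_odd m :
  (q + q^-1) * \tr (burau ([:: pa] ++ wexp [:: pb] (1 + 2 * m))) =
  - (q ^ (2 * m - 1) + q ^ (1 - 2 * m)).
Proof.
move: m; apply: (@recurrence_unique _ (q ^+ 2 + q ^- 2)) => [m|m||].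
- have st n : burau ([:: pa] ++ wexp [:: pb] (n + 1)) =
      burau ([:: pa] ++ wexp [:: pb] n) * burau_letter pb.
    rewrite burau_cat (braid_eqE burau_invariant (wexpS _ _)).
    rewrite [in RHS]burau_cat -mulrA; congr (_ * _).
    by rewrite burau_cat (burau_cons pb) burau_nil mulr1.
  set X := burau ([:: pa] ++ wexp [:: pb] (1 + 2 * (m - 1))).
  have -> : 1 + 2 * (m + 1) = 1 + 2 * (m - 1) + 1 + 1 + 1 + 1 :> int by ring.
  have -> : 1 + 2 * m = 1 + 2 * (m - 1) + 1 + 1 :> int by ring.
  rewrite !st -/X -!mulrA /= !mx2_mul -mulrDr mulrCA; congr (_ * _).
  rewrite -mxtraceZ -[in X in _ + \tr X](mulr1 X) -mx2_1 -raddfD /= -mulrDr scalerAr.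
  congr (\tr (_ * _)).
  by apply/matrixP => -[[|[]] //= ?] -[[|[]] //= ?]; rewrite !mxE /=; field.
- have -> : 2 * (m + 1) - 1 = 2 * m - 1 + 2 :> int by ring.
  have -> : 1 - 2 * (m + 1) = 1 - 2 * m - 2 :> int by ring.
  have -> : 2 * (m - 1) - 1 = 2 * m - 1 - 2 :> int by ring.
  have -> : 1 - 2 * (m - 1) = 1 - 2 * m + 2 :> int by ring.
  have D n : q ^ (n + 2) = q ^ n * q ^+ 2 by rewrite expfzDr.
  have B n : q ^ (n - 2) = q ^ n * q ^- 2 by rewrite expfzDr.
  by rewrite !D !B; ring.
- rewrite -[RHS]/(- (q ^- 1 + q ^+ 1)) /= !burau_cons burau_nil mulr1 mx2_mul.
  by rewrite mx2_trace; field.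
rewrite -[RHS]/(- (q ^- 3 + q ^+ 3)) /= !burau_cons burau_nil mulr1 mx2_mul.
by rewrite mx2_trace; field.
Qed.

(** The hypotheses say that, on the three test words, [f] is the combination of the characters of
    [q] and [- q^-1] and of the Burau trace with weights [s], [t] and [(q + q^-1) * h]. The factor q
    + q^-1 is the one in [burau_trace_odd]. *)
Lemma hecke_trace_normal_word f s h t m p : hecke_trace z f ->
  f [::] = s + t + 2 * ((q + q^-1) * h) ->
  f [:: pa] = q * s - q^-1 * t + z * ((q + q^-1) * h) ->
  f [:: pa; pb] = q ^+ 2 * s + q ^- 2 * t - (q + q^-1) * h ->
  let w := writhe_word (normal_word (1 + 2 * m) p) in
  f (normal_word (1 + 2 * m) p) =
  q ^ w * s + q ^ (- w) * t - (q ^ (2 * m - 1) + q ^ (1 - 2 * m)) * h.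
Proof.
move=> fT f0 fa fab; set W := normal_word _ _; rewrite /=.
set h' := (q + q^-1) * h in f0 fa fab.
have Tq := hecke_trace_linear_char q0 erefl.
have nq0 : - q^-1 != 0 by rewrite oppr_eq0 invr_eq0.
have Tn : hecke_trace z (fun w => (- q^-1) ^ writhe_word w).
  by apply: hecke_trace_linear_char; rewrite // invrN invrK opprK addrC.
have E : forall w, 1 * f w + -1 * (s * q ^ writhe_word w +
    1 * (t * (- q^-1) ^ writhe_word w + h' * \tr (burau w))) = 0.
  have sq (x : F) : x ^ (1 + (1 + 0)) = x ^+ 2 by [].
  apply: (hecke_trace_eq0 (z := z)).
  - apply: hecke_trace_lin fT _; apply: hecke_trace_lin Tq _.
    exact: hecke_trace_lin Tn hecke_trace_burau.
  - by rewrite writhe_word_nil !expr0z burau_nil -mx2_1 mx2_trace f0; ring.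
  - rewrite !writhe_word_cons writhe_word_nil addr0 !expr1z !burau_cons burau_nil.
    by rewrite mulr1 mx2_trace fa /z; ring.
  rewrite !writhe_word_cons writhe_word_nil !sq !burau_cons burau_nil mulr1.
  by rewrite mx2_mul mx2_trace fab; field.
(* The writhe is even because the exponent of sigma_2 is odd, so the sign of [- q^-1] disappears. *)
have even : (- q^-1) ^ writhe_word W = q ^ (- writhe_word W).
  have -> : writhe_word W = 2 * (1 + m + 3 * p) by rewrite writhe_normal_word; ring.
  rewrite -exprz_inv -!exprz_exp -[(- q^-1) ^ 2]/((- q^-1) ^+ 2) sqrrN.
  by rewrite -[q^-1 ^ 2]/(q^-1 ^+ 2).
have trW : (q + q^-1) * \tr (burau W) = - (q ^ (2 * m - 1) + q ^ (1 - 2 * m)).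
  by rewrite -burau_trace_odd /W /normal_word catA burau_cat burau_wexp_full_twist mulr1.
have -> : f W = s * q ^ writhe_word W + t * q ^ (- writhe_word W) +
    h * ((q + q^-1) * \tr (burau W)).
  by apply/eqP; rewrite -subr_eq0 -(E W) even; apply/eqP; rewrite /h'; ring.
by rewrite trW; ring.
Qed.

(* The values at N-1, N-2, N-3, N-4 of the coefficient sequence of
   1 / ((1 - q^3 X) (1 - q X) (1 - q^-1 X) (1 - q^-3 X)), continued to negative
   indices by the recurrence it satisfies (so its value at -4 is -1). *)
Let e1 := q ^+ 3 + q + q^-1 + q ^- 3.
Let e2 := q ^+ 4 + q ^+ 2 + 2 + q ^- 2 + q ^- 4.

Fixpoint box (N : nat) : F * F * F * F :=
  if N is N'.+1 then
    let: (s, h, t, r) := box N' in (e1 * s - e2 * h + e1 * t - r, s, h, t)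
  else (0, 0, 0, -1).

(** The right side is the remainder of x^N modulo the characteristic polynomial of the
    recurrence. *)
Lemma box_root x N : x != 0 ->
  x ^+ 4 - e1 * x ^+ 3 + e2 * x ^+ 2 - e1 * x + 1 = 0 ->
  let: (s, h, t, r) := box N in
  x ^+ N = x * s + (x ^+ 2 - e1 * x) * h +
           (x ^+ 3 - e1 * x ^+ 2 + e2 * x) * t - r.
Proof.
move=> x0 root; elim: N => [|N]; first by rewrite /=; ring.
rewrite /=; case: (box N) => [[[s h] t] r] IH.
(* After the induction hypothesis the two sides differ by [t] times the characteristic polynomial at
   [x]. *)
by rewrite exprS IH -[LHS]subr0 -[X in _ - X](mulr0 t) -root; ring.
Qed.

Hypothesis z0 : z != 0.

(** The left sides are combinations of A^(+-1) and A^(+-3), the N-th powers of the roots q^(+-1) and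
    q^(+-3), to which [box_root] applies. They are [d] times the values of the HOMFLY--PT trace on
    the three test words. *)
Lemma box_bracket N : let: (s, h, t, r) := box N in
  let A := q ^+ N in let d := (A - A^-1) / z in
  [/\ d ^+ 3 = s + t + 2 * ((q + q^-1) * h),
      A * d ^+ 2 = q * s - q^-1 * t + z * ((q + q^-1) * h) &
      A ^+ 2 * d = q ^+ 2 * s + q ^- 2 * t - (q + q^-1) * h].
Proof.
have q'0 : q^-1 != 0 by rewrite invr_eq0.
have A0 : q ^+ N != 0 by rewrite expf_neq0.
have qq : q * q - 1 != 0.
  by have -> : q * q - 1 = q * z; [rewrite /z; field | rewrite mulf_neq0].
have r1 := @box_root q N q0; have r2 := @box_root (q^-1) N q'0.
have r3 := @box_root (q ^+ 3) N (expf_neq0 _ q0).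
have r4 := @box_root (q^-1 ^+ 3) N (expf_neq0 _ q'0).
case: (box N) r1 r2 r3 r4 => [[[s h] t] r] r1 r2 r3 r4.
have {}r1 := r1 ltac:(by rewrite /e1 /e2; field).
have {}r2 := r2 ltac:(by rewrite /e1 /e2; field).
have {}r3 := r3 ltac:(by rewrite /e1 /e2; field).
have {}r4 := r4 ltac:(by rewrite /e1 /e2; field).
rewrite /= in r1 r2 r3 r4 *.
rewrite (exprVn q N) in r2; rewrite exprAC in r3.
rewrite exprAC (exprVn q N) in r4.
move: r1 r2 r3 r4 A0; set A := q ^+ N => r1 r2 r3 r4 A0.
split.
- transitivity ((A ^+ 3 - 3 * A + 3 * A^-1 - A^-1 ^+ 3) / z ^+ 3).
    by field; rewrite ?A0 ?z0.
  by rewrite r3 r4 r2 [X in _ - 3 * X]r1 /e1 /e2 /z; field; rewrite ?q0 ?qq.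
- transitivity ((A ^+ 3 - 2 * A + A^-1) / z ^+ 2); first by field; rewrite ?A0 ?z0.
  by rewrite r3 r2 [X in _ - 2 * X]r1 /e1 /e2 /z; field; rewrite ?q0 ?qq.
transitivity ((A ^+ 3 - A) / z); first by field; rewrite ?A0 ?z0.
by rewrite r3 [X in _ - X]r1 /e1 /e2 /z; field; rewrite ?q0 ?qq.
Qed.
End HeckeFormula.

(** * Power series expansions of rational functions *)

Section Expansion.
Variable F : fieldType.
Implicit Types (c : nat -> F) (P Q : {poly F}).

(** The coefficients of the series [c] times 1 - x X; [is_expansion_mul] uses it to peel one linear
    factor off a denominator. *)
Definition geometric_diff (x : F) c (n : nat) : F :=
  if n is n'.+1 then c n - x * c n' else c 0%N.

Lemma is_expansion_mul x c P Q :
  is_expansion (geometric_diff x c) P Q -> is_expansion c P (Q * (1 - x *: 'X)).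
Proof.
move=> e n; rewrite -e mulrBr mulr1 -scalerAr.
under eq_bigr do rewrite coefB coefZ coefMX mulrBl -mulrA.
rewrite big_split /= sumrN.
case: n => [|n].
  by rewrite !big_ord_recl !big_ord0 /= mul0r mulr0 !addr0 oppr0 addr0 subn0.
rewrite [X in _ - X]big_ord_recl /= mul0r mulr0 add0r.
rewrite [RHS]big_ord_recr /= subnn /= [in LHS]big_ord_recr /= subnn.
rewrite addrAC; congr (_ + _).
rewrite -sumrB; apply: eq_bigr => i _.
by rewrite /bump /= add1n add0n subSS subSn ?leq_ord //= mulrBr mulrCA.
Qed.

Lemma is_expansion1 c P : (forall n, c n = P`_n) -> is_expansion c P 1.
Proof.
move=> e n; rewrite big_ord_recl /= coef1 mul1r subn0 big1 ?addr0 // => i _.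
by rewrite coef1 mul0r.
Qed.

End Expansion.

(** In the variable X / w, the sequences [s], [h], [t] have numerators X, X^2, X^3 over the common
    denominator, and u v = 1 makes the combined numerator factor. *)
Lemma box_expansion (F : fieldType) (q u v w : F) (c : nat -> F) :
  q != 0 -> w != 0 ->
  (forall N, c N = let: (s, h, t, r) := box q N in
     w^-1 ^+ N * (w * s + w^-1 * t - (u + v) * h)) ->
  u * v = 1 ->
  is_expansion c ('X * ((1 - (w ^- 2 * u) *: 'X) * (1 - (w ^- 2 * v) *: 'X)))
    (1 * (1 - (w^-1 * q ^+ 3) *: 'X) * (1 - (w^-1 * q) *: 'X) *
     (1 - (w^-1 * q^-1) *: 'X) * (1 - (w^-1 * q ^- 3) *: 'X)).
Proof.
move=> q0 w0 cE uv.
do 4! apply: is_expansion_mul; apply: is_expansion1 => n.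
have -> : 'X * ((1 - (w ^- 2 * u) *: 'X) * (1 - (w ^- 2 * v) *: 'X)) =
    Poly [:: 0; 1; - (w ^- 2 * (u + v)); w ^- 4].
  rewrite /= !cons_poly_def mul0r add0r -!mul_polyC !rmorphN !rmorphM !rmorph1 /=.
  have -> : (w ^- 4)%:P = (w ^- 2)%:P * (w ^- 2)%:P * (u%:P * v%:P).
    by rewrite -!rmorphM uv mulr1 -invfM -exprD.
  by rewrite rmorphD /=; ring.
rewrite coef_Poly.
(* Degrees 0 to 3 are checked against the initial values of [box]; from degree 4 on the recurrence
   gives zero. *)
case: n => [|[|[|[|n]]]] /=; rewrite !cE /= ?nth_nil.
- by field; rewrite ?w0 ?q0.
- by field; rewrite ?w0 ?q0.
- by field; rewrite ?w0 ?q0.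
- by field; rewrite ?w0 ?q0.
case: (box q n) => [[[s h] t] r].
rewrite !exprS; move: (w^-1 ^+ n) => wn.
by field; rewrite ?w0 ?q0.
Qed.

(** * The HOMFLY--PT trace and the Harer--Zagier transform *)

Section Homfly.
Variables (F : fieldType) (A z : F) (H : odiagram -> F).
Hypotheses (A0 : A != 0) (z0 : z != 0) (H_homfly : is_homfly A z H).

Let H_inv : regular_invariant negb H. Proof. by case: H_homfly. Qed.
Let H_curl : curl_factor negb 1 H. Proof. by case: H_homfly. Qed.
Let H_unknot : H [:: (Cup true, 0%N); (Cap, 0%N)] = 1.
Proof. by case: H_homfly. Qed.
Let H_skein : homfly_skein A z H. Proof. by case: H_homfly. Qed.

Lemma homfly_closure3_skein u v i :
  A * H (closure3 true (u ++ (i, true) :: v)) -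
    A^-1 * H (closure3 true (u ++ (i, false) :: v)) =
  z * H (closure3 true (u ++ v)).
Proof.
pose S3 := [:: true; true; true; false; false; false].
have ru : run negb [::] (cups 3 true ++ word_diagram u) = Some S3.
  by rewrite run_cat /= (@run_word _ negb true).
have E w : closure3 true (u ++ w) =
    (cups 3 true ++ word_diagram u) ++ word_diagram w ++ caps 3.
  by rewrite /closure3 word_diagram_cat -!catA.
have rv : run negb S3 (word_diagram v ++ caps 3) = Some [::].
  by rewrite run_cat (@run_word _ negb true).
have := H_skein (v := word_diagram v ++ caps 3) (i := i) ru.
rewrite !E /link_diagram run_cat ru /= => sk.
by have {sk} := sk _; case: i {ru E} => /=; apply; apply/eqP; exact: rv.
Qed.

Lemma homfly_closure2_nil : H (closure2 true [::]) = (A - A^-1) / z.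
Proof.
(* Either sign of the single crossing is a curl on the unknot, so the skein relation yields the
   value of the two-component unlink. *)
have sk := @H_skein (cups 2 true) (caps 2) 0 [:: true; true; false; false] erefl erefl.
have e b := closure2_markov true H_curl b.
apply: (mulfI z0); rewrite mulrCA mulfV // mulr1 -[LHS]sk /=.
by rewrite !e H_unknot; rewrite invr1 !mulr1.
Qed.

Definition homfly_function (w : word) : F := A ^ writhe_word w * H (closure3 true w).

Lemma homfly_trace : hecke_trace z homfly_function.
Proof.
split; last exact: (twist_cyclic A (closure3_cyclic H_inv true)).
split; first exact: (twist_invariant A (closure3_invariant H_inv true)).
move=> u v i; rewrite /homfly_function mulrCA -(homfly_closure3_skein u v i).
rewrite !writhe_word_cat !writhe_word_cons /= !(expfzDr _ _ A0) expr1z exprN1; ring.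
Qed.

Lemma homfly_function_markov w b : homfly_function (on_first w ++ [:: (true, b)]) =
  A ^ (writhe_word (on_first w) + (if b then 1 else -1)) * H (closure2 true w).
Proof.
rewrite /homfly_function (closure3_markov _ H_inv H_curl) writhe_word_cat.
rewrite writhe_word_cons writhe_word_nil addr0.
by case: b; rewrite ?invr1 mul1r.
Qed.

Lemma homfly_function_ab : homfly_function [:: pa; pb] = A ^+ 2.
Proof.
rewrite (homfly_function_markov [:: true] true) (closure2_markov _ H_curl).
by rewrite H_unknot !mulr1 writhe_word_cons writhe_word_nil.
Qed.

Lemma homfly_function_b b : homfly_function [:: (true, b)] =
  A ^ (if b then 1 else -1) * ((A - A^-1) / z).
Proof.
by rewrite (homfly_function_markov [::]) writhe_word_nil add0r homfly_closure2_nil.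
Qed.

Lemma homfly_function_a : homfly_function [:: pa] = A * ((A - A^-1) / z).
Proof. by rewrite -(hecke_trace_ab homfly_trace) homfly_function_b. Qed.

Lemma homfly_function_nil : homfly_function [::] = ((A - A^-1) / z) ^+ 2.
Proof.
apply: (mulfI z0); have [[_ sk] _] := homfly_trace.
rewrite -(sk [::] [::] true) !homfly_function_b /= expr1z exprN1.
by field; rewrite ?A0 ?z0.
Qed.

Lemma homfly_braid_eq w w' : braid_eq w w' ->
  H (closure3 true w) = H (closure3 true w').
Proof. exact: braid_eqE (closure3_invariant H_inv true). Qed.

End Homfly.

Lemma family_HZ (F : fieldType) (H : F -> F -> odiagram -> F)
  (H_homfly : forall A z : F, A != 0 -> z != 0 -> is_homfly A z (H A z))
  (neg : bool) (j k l : int) : HZ_factorisable H 3 (Kjkl neg j k l).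
Proof.
have [m nm] := family_exponent_odd neg j k; set p := l + k.
pose w := writhe_word (normal_word (1 + 2 * m) p).
(* The exponents are those of [box_expansion] with q^w for its [w], and q^(2m-1) and q^(1-2m) for
   [u] and [v]. *)
exists (fun i : 'I_2 => - w - w + (if i == 0 then 2 * m - 1 else 1 - 2 * m)).
exists (fun i : 'I_4 => - w + nth 0 [:: 3; 1; -1; -3] i).
move=> q q0 z0.
have W0 : q ^ w != 0 by rewrite expfz_neq0.
have := @box_expansion F q (q ^ (2 * m - 1)) (q ^ (1 - 2 * m)) (q ^ w)
  (HZ_coef H (braid_closure 3 (Kjkl neg j k l)) q) q0 W0.
have -> : \prod_i (1 - q ^ (- w - w +
      (if i == 0 :> 'I_2 then 2 * m - 1 else 1 - 2 * m)) *: 'X) =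
  (1 - ((q ^ w) ^- 2 * q ^ (2 * m - 1)) *: 'X) *
  (1 - ((q ^ w) ^- 2 * q ^ (1 - 2 * m)) *: 'X).
  rewrite !big_ord_recl big_ord0 mulr1 /= !(expfzDr _ _ q0) -!invr_expz.
  by rewrite -invfM.
have -> : \prod_(i : 'I_4) (1 - q ^ (- w + nth 0 [:: 3; 1; -1; -3] i) *: 'X) =
   1 * (1 - ((q ^ w)^-1 * q ^+ 3) *: 'X) * (1 - ((q ^ w)^-1 * q) *: 'X) *
     (1 - ((q ^ w)^-1 * q^-1) *: 'X) * (1 - ((q ^ w)^-1 * q ^- 3) *: 'X).
  by rewrite !big_ord_recr big_ord0 /= !(expfzDr _ _ q0) -!invr_expz.
apply; last first.
  rewrite -expfzDr // -[RHS](expr0z q); congr (q ^ _); ring.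
move=> N; set A := q ^+ N; have A0 : A != 0 by rewrite expf_neq0.
have hA := H_homfly A (q - q^-1) A0 z0.
rewrite /HZ_coef /homfly_bar -/A Kjkl_word braid_closure_word.
rewrite (homfly_braid_eq hA (family_wordE _ _ _ _)) nm -/p.
have := box_bracket q0 z0 N; case: (box q N) => [[[s h] t] r] [b0 ba bab].
set c := (A - A^-1) / (q - q^-1); pose g := homfly_function A (H A (q - q^-1)).
rewrite -/A -/c in b0 ba bab.
(* The factor [c] passes to the unnormalised polynomial; the summand with coefficient zero gives the
   shape of [hecke_trace_lin]. *)
have T : hecke_trace (q - q^-1) (fun w => c * g w + 0 * g w).
  by apply: hecke_trace_lin; apply: homfly_trace.
have := hecke_trace_normal_word (s := s) (h := h) (t := t) q0 m p T.
rewrite !mul0r !addr0 /g (homfly_function_nil A0 z0 hA).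
rewrite (homfly_function_a A0 z0 hA) (homfly_function_ab hA) -b0 -ba -bab -/c -/w => e.
have {}e := e ltac:(ring) ltac:(ring) ltac:(ring).
(* At A = q^N the writhe factor is an N-th power, which is the rescaling of the variable in
   [box_expansion]. *)
have AW : A ^ w = (q ^ w) ^+ N by rewrite /A !exprnP !exprz_exp mulrC.
have AWinv : (q ^ w)^-1 ^+ N * A ^ w = 1.
  by rewrite AW -exprMn mulVf // expr1n.
rewrite invr_expz -e /homfly_function -/w mulrCA [RHS]mulrA -invr_expz.
by rewrite -mulrA (mulrA _ (A ^ w)) AWinv mul1r.
Qed.

(** * Kauffman functionals and turnbacks *)

(** Written as [[:: pb; pa; pa; pb; pa; pa]], the full twist absorbs all inverse letters, up to
    cyclic rotation. *)
Lemma full_twist_cancel (R : Type) (g : word -> R) :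
  braid_invariant g -> cyclic_invariant g ->
  [/\ g ([:: na; na] ++ full_twist) = g [:: pa; pa; pb; pb],
      g ([:: na; nb] ++ full_twist) = g [:: pa; pa; pa; pb] &
      g ([:: na; na; nb] ++ full_twist) = g [:: pa; pa; pb]].
Proof.
move=> gi gc; have [R2 _] := gi.
have E u : g (u ++ full_twist) = g (u ++ [:: pb; pa; pa; pb; pa; pa]).
  by apply: braid_eqE gi _; apply: braid_eq_cat => //; exact: (full_twistE3 true).
split; rewrite E.
- rewrite gc /= (R2 [:: pb; pa; pa; pb; pa] [:: na] false true) /=.
  by rewrite (R2 [:: pb; pa; pa; pb] [::] false true) /= (gc [:: pb]).
- rewrite /= (R2 [:: na] _ true false) /= (R2 [::] _ false false) /=.
  exact: (gc [:: pa; pb]).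
rewrite /= (R2 [:: na; na] _ true false) /= (R2 [:: na] _ false false) /=.
by rewrite (R2 [::] _ false false) /= (gc [:: pb]).
Qed.

(* For [J = I] and [B = A], or [J = - I] and [B = - A], the parameters [J * B] and
   [J * z] are those of the theorem; the factor [J ^ - w] turns the Kauffman
   skein relation into [psi(+) - psi(-) = z (psi(0) + psi(oo))]. *)
Section Kauffman.
Variables (F : fieldType) (J B z : F) (L : udiagram -> F).
Hypotheses (J2 : J ^+ 2 = -1) (B0 : B != 0) (z0 : z != 0).
Hypothesis L_kauffman : is_kauffman (J * B) (J * z) L.

Let L_inv : regular_invariant id L. Proof. by case: L_kauffman. Qed.
Let L_curl : curl_factor id (J * B) L. Proof. by case: L_kauffman. Qed.
Let L_unknot : L [:: (Cup tt, 0%N); (Cap, 0%N)] = 1.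
Proof. by case: L_kauffman. Qed.
Let L_skein : kauffman_skein (J * z) L. Proof. by case: L_kauffman. Qed.

Let J0 : J != 0.
Proof. by apply: contra_eq_neq J2 => ->; rewrite expr0n /= eq_sym oppr_eq0 oner_eq0. Qed.
Let JV : J^-1 = - J.
Proof. by apply: (mulfI J0); rewrite mulfV // mulrN -expr2 J2 opprK. Qed.

(** The second smoothing of a crossing: the generator e_i of the Birman--Murakami--Wenzl algebra. *)
Definition turnback (i : bool) : udiagram :=
  [:: (Cap, nat_of_bool i); (Cup tt, nat_of_bool i)].

Definition turnback_closure (i : bool) (u v : word) : udiagram :=
  cups 3 tt ++ word_diagram u ++ turnback i ++ word_diagram v ++ caps 3.

Definition kauffman_function (w : word) : F :=
  J ^ (- writhe_word w) * L (closure3 tt w).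
Definition kauffman_turnback (i : bool) (u v : word) : F :=
  J ^ (- writhe_word (u ++ v)) * L (turnback_closure i u v).
Definition kauffman_function2 (w : seq bool) : F :=
  J ^ (- writhe_word (on_first w)) * L (closure2 tt w).
Definition kauffman_turnback2 (w : seq bool) : F :=
  J ^ (- writhe_word (on_first w)) *
  L (cups 2 tt ++ first_diagram w ++ turnback false ++ caps 2).

Local Notation S3 := (nseq 6 tt).
Let run3 w : run id S3 (word_diagram w) = Some S3.
Proof. exact: (@run_word _ id tt). Qed.
Let run2 w : run id (nseq 4 tt) (first_diagram w) = Some (nseq 4 tt).
Proof. exact: (@run_first _ id tt). Qed.

Let J_skein n x y u : x + y = J * z * u ->
  J ^ (- (n + 1)) * x - J ^ (- (n - 1)) * y = z * (J ^ (- n) * u).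
Proof.
move=> e; rewrite !opprD opprK !(expfzDr _ _ J0) exprN1 expr1z JV.
transitivity (J ^ (- n) * (- J * (x + y))); first by ring.
rewrite e; transitivity (- J ^+ 2 * (z * (J ^ (- n) * u))); first by ring.
by rewrite J2 opprK mul1r.
Qed.

Lemma kauffman_function_skein u v i :
  kauffman_function (u ++ (i, true) :: v) - kauffman_function (u ++ (i, false) :: v) =
  z * (kauffman_function (u ++ v) + kauffman_turnback i u v).
Proof.
have e w : closure3 tt (u ++ w) =
    (cups 3 tt ++ word_diagram u) ++ word_diagram w ++ caps 3.
  by rewrite /closure3 word_diagram_cat -!catA.
have sk := @L_skein (cups 3 tt ++ word_diagram u) (word_diagram v ++ caps 3) i.
rewrite /kauffman_function /kauffman_turnback -mulrDr.
rewrite [writhe_word (u ++ _ :: _)]writhe_word_cat writhe_word_cons.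
rewrite [writhe_word (u ++ (i, false) :: _)]writhe_word_cat writhe_word_cons.
rewrite !(addrCA (writhe_word u)) -writhe_word_cat !(addrC _ (writhe_word _)).
have et : turnback_closure i u v =
    (cups 3 tt ++ word_diagram u) ++ turnback i ++ word_diagram v ++ caps 3.
  by rewrite /turnback_closure -[RHS]catA.
apply: J_skein; rewrite !e et.
apply: sk; rewrite /link_diagram run_cat run_cat /= run3 /=.
have rv : run id S3 (word_diagram v ++ caps 3) = Some [::] by rewrite run_cat run3.
by case: i {et}; apply/eqP; exact: rv.
Qed.

(** Centrality brings the full twist down to the cup of the turnback. There its first two letters
    are negative curls, and the cup is pulled off the strand that the other four take around it. *)
Lemma turnback_full_twist i u v :
  L (turnback_closure i u (v ++ full_twist)) = (J * B) ^- 2 * L (turnback_closure i u v).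
Proof.
pose P := cups 3 tt ++ word_diagram u ++ [:: (Cap, nat_of_bool i)].
have rP : run id [::] P = Some (nseq 4 tt) by rewrite run_cat /= run_cat run3; case: (i).
have e w : turnback_closure i u w =
    (P ++ [:: (Cup tt, nat_of_bool i)]) ++ word_diagram w ++ caps 3.
  by rewrite /turnback_closure /P -!catA.
have rP' : run id [::] (P ++ [:: (Cup tt, nat_of_bool i)]) = Some S3.
  by rewrite run_cat rP; case: (i).
have ci := context_invariant (o := tt) (Q := caps 3) L_inv rP' erefl.
pose t := [:: (~~ i, true); (i, true); (i, true); (~~ i, true)].
have tE : braid_eq (v ++ full_twist) ([:: (i, true); (i, true)] ++ t ++ v).
  apply: braid_eq_trans (braid_eq_sym (full_twist_central v)) _.
  exact: (braid_eq_cat (full_twistE2 i) (@braid_eq_refl v)).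
have rv w : run id S3 (word_diagram w ++ caps 3) = Some [::] by rewrite run_cat run3.
have link D w : run id (nseq 4 tt) D = Some S3 ->
    link_diagram id (P ++ D ++ word_diagram w ++ caps 3).
  by move=> rD; rewrite /link_diagram run_cat rP /= run_cat rD /= rv.
have e2 D : (P ++ [:: (Cup tt, nat_of_bool i)]) ++ D =
    P ++ [:: (Cup tt, nat_of_bool i)] ++ D by rewrite -catA.
rewrite !e (braid_eqE ci tE) {e rP' ci tE} !e2.
have curl w : L (P ++ [:: (Cup tt, nat_of_bool i); (Cross true, nat_of_bool i)] ++
      word_diagram w ++ caps 3) =
    (J * B)^-1 * L (P ++ [:: (Cup tt, nat_of_bool i)] ++ word_diagram w ++ caps 3).
  by apply: (L_curl (curl_cup id tt true i)); apply: link; case: (i).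
transitivity ((J * B)^-1 * L (P ++ [:: (Cup tt, nat_of_bool i)] ++
    word_diagram ((i, true) :: t ++ v) ++ caps 3)).
  exact: (curl ((i, true) :: t ++ v)).
transitivity ((J * B)^-1 * ((J * B)^-1 * L (P ++ [:: (Cup tt, nat_of_bool i)] ++
    word_diagram (t ++ v) ++ caps 3))).
  by congr (_ * _); exact: (curl (t ++ v)).
rewrite mulrA -expr2 exprVn; congr (_ * _).
have [_ _ /(_ P (word_diagram v ++ caps 3) rP)] :=
  cup_around_strand L_inv tt i tt tt tt tt.
rewrite word_diagram_cat -catA; apply.
by case: (i); apply: rv.
Qed.

Lemma turnback_curl i u b v : L (turnback_closure i (u ++ [:: (i, b)]) v) =
  (if b then (J * B)^-1 else J * B) * L (turnback_closure i u v).
Proof.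
have e w : turnback_closure i (u ++ w) v = (cups 3 tt ++ word_diagram u) ++
    (word_diagram w ++ [:: (Cap, nat_of_bool i)]) ++
    (Cup tt, nat_of_bool i) :: word_diagram v ++ caps 3.
  by rewrite /turnback_closure word_diagram_cat -!catA.
rewrite e -[in RHS](cats0 u) e -if_neg.
have rv : run id S3 (word_diagram v ++ caps 3) = Some [::] by rewrite run_cat run3.
have link w : link_diagram id ((cups 3 tt ++ word_diagram u) ++
    (word_diagram w ++ [:: (Cap, nat_of_bool i)]) ++
    (Cup tt, nat_of_bool i) :: word_diagram v ++ caps 3).
  rewrite /link_diagram run_cat run_cat /= run3 /= run_cat run_cat run3 /=.
  by case: (i); apply/eqP; exact: rv.
apply: (L_curl (curl_cap id b i)); first exact: (link [:: (i, b)]).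
exact: (link [::]).
Qed.

(** With the third cup raised, the turnback and the third cup and cap form two zigzags, which
    straighten. *)
Lemma turnback_closure2 w :
  L (turnback_closure true (on_first w) [::]) = L (closure2 tt w).
Proof.
rewrite /turnback_closure.
rewrite -[turnback true ++ _]/([:: (Cap, 1); (Cup tt, 1); (Cap, 2)]%N ++ caps 2).
rewrite (closure3_third_cup L_inv) //.
have d : diagram_eq id L (nseq 4 tt) (nseq 4 tt)
    [:: (Cup tt, 2); (Cap, 1); (Cup tt, 1); (Cap, 2)]%N [::].
  apply: diagram_eq_trans (@diagram_eq_move _ _ _ _ L_inv _ _ [::] _ _
    [:: (Cup tt, 1); (Cap, 2)]%N (move_zigzagr tt 1) _ _) _ => //.
  exact: (@diagram_eq_move _ _ _ _ L_inv _ _ [::] _ _ [::] (move_zigzagl tt 1)).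
have e D : (cups 2 tt ++ first_diagram w) ++ D = cups 2 tt ++ first_diagram w ++ D.
  by rewrite -catA.
case: d => _ _ /(_ (cups 2 tt ++ first_diagram w) (caps 2)); rewrite !e; apply=> //.
by rewrite run_cat /= run2.
Qed.

Lemma turnback2_curl u b :
  L (cups 2 tt ++ first_diagram (u ++ [:: b]) ++ turnback false ++ caps 2) =
  (if b then (J * B)^-1 else J * B) *
  L (cups 2 tt ++ first_diagram u ++ turnback false ++ caps 2).
Proof.
rewrite /first_diagram map_cat -if_neg -/(first_diagram u).
have := L_curl (u := cups 2 tt ++ first_diagram u)
  (v := (Cup tt, 0%N) :: caps 2) (curl_cap id b 0).
have e D : (cups 2 tt ++ first_diagram u) ++ D = cups 2 tt ++ first_diagram u ++ D.
  by rewrite -catA.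
rewrite !e -catA; apply; first by rewrite /link_diagram run_cat /= run_cat run2.
by rewrite /link_diagram run_cat /= run_cat run2.
Qed.

Lemma turnback2_nil : L (cups 2 tt ++ turnback false ++ caps 2) = 1.
Proof.
have d : diagram_eq id L [::] [::] (cups 2 tt ++ turnback false ++ caps 2)
    [:: (Cup tt, 0); (Cap, 0)]%N.
  apply: diagram_eq_trans (@diagram_eq_move _ _ _ _ L_inv _ _ [:: (Cup tt, 0)]%N _ _
    [:: (Cup tt, 0); (Cap, 1); (Cap, 0)]%N (move_zigzagr tt 0) _ _) _ => //.
  exact: (@diagram_eq_move _ _ _ _ L_inv _ _ [:: (Cup tt, 0)]%N _ _ [:: (Cap, 0)]%N
    (move_zigzagl tt 0)).
by rewrite -L_unknot; apply: diagram_eq_link d.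
Qed.

Let J_add m n : J ^ (- (m + n)) = J ^ (- m) * J ^ (- n).
Proof. by rewrite opprD (expfzDr _ _ J0). Qed.

(** The writhe 6 of the full twist contributes J^-6 = -1, which cancels the sign in (J B)^-2 =
    -B^-2. *)
Lemma kauffman_turnback_full_twist i u v :
  kauffman_turnback i u (v ++ full_twist) = B ^- 2 * kauffman_turnback i u v.
Proof.
rewrite /kauffman_turnback turnback_full_twist catA writhe_word_cat.
have J6 : J ^ (- 6) = -1.
  by rewrite -invr_expz -[J ^ 6]/(J ^+ (2 * 3)) exprM J2 -signr_odd expr1 invrN1.
by rewrite writhe_word_full_twist J_add J6 exprMn J2 mulN1r invrN; ring.
Qed.

Lemma kauffman_turnback_curl i u b v :
  kauffman_turnback i (u ++ [:: (i, b)]) v =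
  (if b then - B^-1 else - B) * kauffman_turnback i u v.
Proof.
rewrite /kauffman_turnback turnback_curl -catA !writhe_word_cat writhe_word_cons.
rewrite writhe_word_nil addr0 !J_add.
case: b; rewrite ?opprK ?expr1z ?exprN1 ?invfM ?JV.
  transitivity (J ^+ 2 * (B^-1 * (J ^ (- writhe_word u) * J ^ (- writhe_word v) *
    L (turnback_closure i u v)))); first by ring.
  by rewrite J2; ring.
transitivity (J ^+ 2 * (B * (J ^ (- writhe_word u) * J ^ (- writhe_word v) *
  L (turnback_closure i u v)))); first by ring.
by rewrite J2; ring.
Qed.

Lemma kauffman_turnback_invariant i v :
  braid_invariant (fun w => kauffman_turnback i w v).
Proof.
have rQ : run id S3 (turnback i ++ word_diagram v ++ caps 3) = Some [::].
  have rv : run id S3 (word_diagram v ++ caps 3) = Some [::] by rewrite run_cat run3.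
  by case: (i); exact: rv.
have ci := context_invariant (o := tt) (P := cups 3 tt) L_inv erefl rQ.
have [w2 w3] := twist_invariant J^-1 ci.
have e w : kauffman_turnback i w v = J ^ (- writhe_word v) *
    (J^-1 ^ writhe_word w * L (turnback_closure i w v)).
  by rewrite /kauffman_turnback writhe_word_cat J_add exprz_inv mulrA mulrAC mulrC mulrA.
split=> [u u' j b|u u' j]; rewrite !e; congr (_ * _); first exact: (w2 u u' j b).
exact: (w3 u u' j).
Qed.

Lemma kauffman_turnback_on_first w :
  kauffman_turnback true (on_first w) [::] = kauffman_function2 w.
Proof. by rewrite /kauffman_turnback turnback_closure2 cats0. Qed.

Lemma kauffman_function_markov w b :
  kauffman_function (on_first w ++ [:: (true, b)]) =
  (if b then B else B^-1) * kauffman_function2 w.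
Proof.
rewrite /kauffman_function (closure3_markov _ L_inv L_curl) writhe_word_cat J_add.
rewrite writhe_word_cons writhe_word_nil addr0 /kauffman_function2.
by case: b; rewrite ?opprK ?expr1z ?exprN1 ?invfM; field; rewrite ?B0 ?J0.
Qed.

Lemma kauffman_function2_letter b : kauffman_function2 [:: b] = if b then B else B^-1.
Proof.
rewrite /kauffman_function2 (closure2_markov _ L_curl) L_unknot mulr1.
rewrite writhe_word_cons writhe_word_nil addr0.
by case: b; rewrite ?opprK ?expr1z ?exprN1 ?invfM; field; rewrite ?B0 ?J0.
Qed.

Lemma kauffman_function2_skein u :
  kauffman_function2 (u ++ [:: true]) - kauffman_function2 (u ++ [:: false]) =
  z * (kauffman_function2 u + kauffman_turnback2 u).
Proof.
rewrite /kauffman_function2 /kauffman_turnback2 -mulrDr.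
rewrite /on_first !map_cat !writhe_word_cat !writhe_word_cons writhe_word_nil !addr0.
apply: J_skein.
have e D : (cups 2 tt ++ first_diagram u) ++ D = cups 2 tt ++ first_diagram u ++ D.
  by rewrite -catA.
have := L_skein (u := cups 2 tt ++ first_diagram u) (v := caps 2) (i := 0).
rewrite !e /closure2 /first_diagram !map_cat -!catA; apply.
by rewrite /link_diagram run_cat /= run_cat run2.
Qed.

Lemma kauffman_turnback2_curl u b :
  kauffman_turnback2 (u ++ [:: b]) = (if b then - B^-1 else - B) * kauffman_turnback2 u.
Proof.
rewrite /kauffman_turnback2 turnback2_curl /on_first map_cat writhe_word_cat.
rewrite writhe_word_cons writhe_word_nil addr0 !J_add.
case: b; rewrite ?opprK ?expr1z ?exprN1 ?invfM ?JV; set x := J ^ _; set y := L _.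
  by transitivity (J ^+ 2 * (B^-1 * (x * y))); [ring | rewrite J2; ring].
by transitivity (J ^+ 2 * (B * (x * y))); [ring | rewrite J2; ring].
Qed.

Lemma kauffman_turnback2_nil : kauffman_turnback2 [::] = 1.
Proof.
rewrite /kauffman_turnback2 [first_diagram _]/= turnback2_nil writhe_word_nil.
by rewrite oppr0 expr0z mulr1.
Qed.

Lemma kauffman_function_invariant : braid_invariant kauffman_function.
Proof.
have w1 : braid_invariant (fun w => J^-1 ^ writhe_word w * L (closure3 tt w)).
  exact: twist_invariant (closure3_invariant L_inv tt).
split=> [u v i b|u v i]; rewrite /kauffman_function -!exprz_inv.
  exact: (w1.1 u v i b).
exact: (w1.2 u v i).
Qed.

Lemma kauffman_function_cyclic : cyclic_invariant kauffman_function.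
Proof.
move=> u v; rewrite /kauffman_function -!exprz_inv.
exact: (twist_cyclic J^-1 (closure3_cyclic L_inv tt) u v).
Qed.

(** The turnback term at [w ++ full_twist] is B^-2 times the one at [w], so the combination
    satisfies the Hecke relation. *)
Lemma kauffman_shift_trace : hecke_trace z
  (fun w => 1 * kauffman_function (w ++ full_twist) + - B ^- 2 * kauffman_function w).
Proof.
have gi := kauffman_function_invariant; have gc := kauffman_function_cyclic.
split; first split.
- exact: braid_invariant_lin (shift_invariant gi) gi.
- move=> u v i; have := kauffman_function_skein u v i.
  have := kauffman_function_skein u (v ++ full_twist) i.
  rewrite kauffman_turnback_full_twist -!catA !cat_cons => e1 e2.
  transitivity (z * (kauffman_function (u ++ v ++ full_twist) +
      B ^- 2 * kauffman_turnback i u v) -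
    B ^- 2 * (z * (kauffman_function (u ++ v) + kauffman_turnback i u v))).
    by rewrite -e1 -e2; ring.
  by ring.
by move=> u v; rewrite (shift_cyclic gi gc u v) (gc u v).
Qed.

(** The factor contributed by a separate circle. *)
Let delta := (B - B^-1) / z - 1.

Lemma kauffman_function2_cancel u b :
  kauffman_function2 (u ++ [:: b; ~~ b]) = kauffman_function2 u.
Proof.
rewrite -!kauffman_turnback_on_first /on_first map_cat.
have [R2 _] := kauffman_turnback_invariant true [::].
by rewrite (R2 _ [::] false b) cats0.
Qed.

Lemma kauffman_function2_nil : kauffman_function2 [::] = delta.
Proof.
have := kauffman_function2_skein [::].
rewrite /= !kauffman_function2_letter kauffman_turnback2_nil /delta => e.
by apply: (mulfI z0); apply: (addIr (z * 1)); rewrite -mulrDr -e; field; rewrite ?B0 ?z0.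
Qed.

Lemma kauffman_function2_tt :
  kauffman_function2 [:: true; true] = delta + z * (B - B^-1).
Proof.
have := kauffman_function2_skein [:: true].
rewrite /= (kauffman_function2_cancel [::] true) kauffman_function2_nil.
rewrite kauffman_function2_letter (kauffman_turnback2_curl [::] true).
by rewrite kauffman_turnback2_nil mulr1 => /eqP; rewrite subr_eq => /eqP ->; ring.
Qed.

Lemma kauffman_function2_ff :
  kauffman_function2 [:: false; false] = delta + z * (B - B^-1).
Proof.
have := kauffman_function2_skein [:: false].
rewrite /= (kauffman_function2_cancel [::] false) kauffman_function2_nil.
rewrite kauffman_function2_letter (kauffman_turnback2_curl [::] false).
rewrite kauffman_turnback2_nil mulr1 => /eqP; rewrite subr_eq addrC -subr_eq => /eqP <-.
by ring.
Qed.

Lemma kauffman_function2_ttt : kauffman_function2 [:: true; true; true] =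
  B + z * (delta + z * (B - B^-1) + B ^- 2).
Proof.
have := kauffman_function2_skein [:: true; true].
rewrite /= (kauffman_function2_cancel [:: true] true) kauffman_function2_tt.
rewrite kauffman_function2_letter (kauffman_turnback2_curl [:: true] true).
rewrite (kauffman_turnback2_curl [::] true) kauffman_turnback2_nil mulr1.
by move/eqP; rewrite subr_eq => /eqP ->; field; rewrite ?B0 ?z0.
Qed.

(** The third strand closes to a separate circle. Its factor comes from the skein relation at an
    additional sigma_2: both signs are curls and the turnback leaves the two-strand closure. *)
Lemma kauffman_function_first w :
  kauffman_function (on_first w) = delta * kauffman_function2 w.
Proof.
have := kauffman_function_skein (on_first w) [::] true.
rewrite !kauffman_function_markov cats0 kauffman_turnback_on_first.
rewrite -mulrBl => e; apply: (mulfI z0); apply: (addIr (z * kauffman_function2 w)).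
by rewrite -mulrDr -e /delta; field; rewrite ?B0 ?z0.
Qed.

(** The closure is a connected sum of two Hopf links, whence the square. *)
Lemma kauffman_function_aabb : kauffman_function [:: pa; pa; pb; pb] =
  (delta + z * (B - B^-1)) ^+ 2.
Proof.
have := kauffman_function_skein [:: pa; pa; pb] [::] true.
have [R2 _] := kauffman_function_invariant.
rewrite /= (R2 [:: pa; pa] [::] true true) /=.
rewrite (kauffman_turnback_curl true [:: pa; pa] true).
rewrite (kauffman_function_first [:: true; true]).
rewrite (kauffman_turnback_on_first [:: true; true]).
rewrite (kauffman_function_markov [:: true; true] true) kauffman_function2_tt.
by move/eqP; rewrite subr_eq => /eqP ->; ring.
Qed.

Lemma kauffman_shift_values :
  let T := delta + z * (B - B^-1) in
  let g w := 1 * kauffman_function (w ++ full_twist) + - B ^- 2 * kauffman_function w in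
  [/\ g [:: na; na] = T ^+ 2 - B ^- 2 * (delta * T),
      g [:: na; nb] = B * (B + z * (T + B ^- 2)) - B ^- 4 &
      g [:: na; na; nb] = B * T - B ^- 3 * T].
Proof.
have [e1 e2 e3] := full_twist_cancel kauffman_function_invariant kauffman_function_cyclic.
split; rewrite ?e1 ?e2 ?e3.
- rewrite kauffman_function_aabb (kauffman_function_first [:: false; false]).
  by rewrite kauffman_function2_ff; ring.
- rewrite (kauffman_function_markov [:: true; true; true] true) kauffman_function2_ttt.
  rewrite (kauffman_function_markov [:: false] false) kauffman_function2_letter.
  by field; rewrite ?B0 ?z0.
rewrite (kauffman_function_markov [:: true; true] true) kauffman_function2_tt.
rewrite (kauffman_function_markov [:: false; false] false) kauffman_function2_ff.
by field; rewrite ?B0 ?z0.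
Qed.

Lemma kauffman_function_ab b :
  kauffman_function [:: pa; (true, b)] = if b then B ^+ 2 else 1.
Proof.
rewrite (kauffman_function_markov [:: true] b) kauffman_function2_letter.
by case: b; rewrite ?mulVf.
Qed.

(** In the turnback term the power of sigma_2 unwinds as curls below the cap, each contributing
    -B^-1, and the remaining sigma_1 closes to a curl of value B. *)
Lemma kauffman_function_wexp n :
  kauffman_function ([:: pa] ++ wexp [:: pb] (n + 1)) -
    kauffman_function ([:: pa] ++ wexp [:: pb] (n - 1)) =
  z * (kauffman_function ([:: pa] ++ wexp [:: pb] n) + B * (- B) ^ (- n)).
Proof.
have ti := kauffman_turnback_invariant true [::].
have tb : kauffman_turnback true ([:: pa] ++ wexp [:: pb] n) [::] = B * (- B) ^ (- n).
  elim/int_bi_ind: n => [|n].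
    rewrite -[[:: pa] ++ _]/(on_first [:: true]) kauffman_turnback_on_first.
    by rewrite kauffman_function2_letter oppr0 expr0z mulr1.
  have -> : kauffman_turnback true ([:: pa] ++ wexp [:: pb] (n + 1)) [::] =
      - B^-1 * kauffman_turnback true ([:: pa] ++ wexp [:: pb] n) [::].
    rewrite -(kauffman_turnback_curl _ _ true) -catA; apply: (braid_eqE ti).
    exact: (@braid_eq_cat [:: pa] [:: pa] _ _ _ (wexpS _ _)).
  have nB0 : - B != 0 by rewrite oppr_eq0.
  have -> : B * (- B) ^ (- (n + 1)) = - B^-1 * (B * (- B) ^ (- n)).
    by rewrite opprD (expfzDr _ _ nB0) exprN1 invrN; ring.
  by split=> [-> //|]; apply: mulfI; rewrite oppr_eq0 invr_eq0.
have := kauffman_function_skein ([:: pa] ++ wexp [:: pb] n) [::] true.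
rewrite cats0 tb => <-.
have gi := kauffman_function_invariant.
congr (_ - _); apply: braid_eqE gi _; rewrite -catA.
  exact: (@braid_eq_cat [:: pa] [:: pa] _ _ _ (wexpS _ _)).
exact: (@braid_eq_cat [:: pa] [:: pa] _ _ _ (wexpB true _)).
Qed.

End Kauffman.

(** * Values of Hecke traces on short words *)

Section HeckeValues.
Variables (F : fieldType) (z : F) (g : word -> F).
Hypothesis gT : hecke_trace z g.
Let gH : hecke z g. Proof. by case: gT. Qed.

Lemma hecke_wexp n :
  g ([:: pa] ++ wexp [:: pb] (n + 1)) - g ([:: pa] ++ wexp [:: pb] (n - 1)) =
  z * g ([:: pa] ++ wexp [:: pb] n).
Proof.
case: (gH) => gi sk; have := sk ([:: pa] ++ wexp [:: pb] n) [::] true.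
rewrite cats0 => <-; congr (_ - _); apply: braid_eqE gi _; rewrite -catA.
  exact: (@braid_eq_cat [:: pa] [:: pa] _ _ _ (wexpS _ _)).
exact: (@braid_eq_cat [:: pa] [:: pa] _ _ _ (wexpB true _)).
Qed.

Let f0 := g [::].
Let fa := g [:: pa].
Let fab := g [:: pa; pb].

Lemma hecke_values_pos :
  [/\ g [:: pa; nb] = fab - z * fa,
      g [:: pa; pa; pb] = z * fab + fa,
      g [:: pa; pa; pa; pb] = z * (z * fab + fa) + fab &
      g [:: pa; pa; pb; pb] = z * (z * fab + fa) + (z * fa + f0)].
Proof.
have aab : g [:: pa; pa; pb] = z * fab + fa.
  by rewrite (hecke_sq gH [::]) /= (hecke_trace_ab gT).
split=> //; first by rewrite (hecke_neg gH [:: pa] [::]).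
  by rewrite (hecke_sq gH [::]) /= aab.
by rewrite (hecke_sq gH [:: pa; pa] [::]) /= aab (hecke_sq gH [::] [::]).
Qed.

Lemma hecke_values_neg :
  [/\ g [:: na; na] = f0 - z * (fa - z * f0),
      g [:: na; nb] = fab - z * fa - z * (fa - z * f0) &
      g [:: na; na; nb] = fa - z * f0 - z * (fab - z * fa - z * (fa - z * f0))].
Proof.
have [R2 _] := gH.1; have [anb _ _ _] := hecke_values_pos.
have na1 : g [:: na] = fa - z * f0 by rewrite (hecke_neg gH [::] [::]).
have nb1 : g [:: nb] = fa - z * f0.
  by rewrite (hecke_neg gH [::] [::]) /= (hecke_trace_ab gT).
have nanb : g [:: na; nb] = fab - z * fa - z * (fa - z * f0).
  by rewrite (hecke_neg gH [::] [:: nb]) /= anb nb1.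
split=> //; first by rewrite (hecke_neg gH [::] [:: na]) /= (R2 [::] [::] false true) na1.
by rewrite (hecke_neg gH [::] [:: na; nb]) /= (R2 [::] [:: nb] false true) /= nb1 nanb.
Qed.

End HeckeValues.

(** * The HOMFLY--PT/Kauffman relation *)

Section Relation.
Variables (F : fieldType) (I A z : F) (H : odiagram -> F) (Lp Lm : udiagram -> F).
Hypotheses (two0 : 2%:R != 0 :> F) (I2 : I ^+ 2 = -1).
Hypotheses (A0 : A != 0) (z0 : z != 0) (V0 : A - A^-1 != 0).
Hypotheses (H_homfly : is_homfly A z H) (Lp_kauffman : is_kauffman (I * A) (I * z) Lp).
Hypothesis (Lm_kauffman : is_kauffman (I * A) (- (I * z)) Lm).

Let Lm_kauffman' : is_kauffman (- I * - A) (- I * z) Lm.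
Proof. by rewrite mulrNN mulNr. Qed.
Let I2' : (- I) ^+ 2 = -1. Proof. by rewrite sqrrN. Qed.
Let A0' : - A != 0. Proof. by rewrite oppr_eq0. Qed.

Let V := A - A^-1.
(** [cp] and [cm] are the coefficients of the two Kauffman values once the even and odd parts are
    expanded. *)
Let cp := 2%:R^-1 * (1 - z / V).
Let cm := 2%:R^-1 * (1 + z / V).
Let hf := homfly_function A H.
Let kp := kauffman_function I Lp.
Let km := kauffman_function (- I) Lm.

(** On words of even writhe this is A^writhe times the difference of the two sides of the relation;
    evenness matters because [km] carries a power of [- I] instead of [I]. *)
Definition defect (w : word) : F := 1 * hf w + -1 * (cp * kp w + cm * km w).

Lemma defect_invariant : braid_invariant defect.
Proof.
apply: braid_invariant_lin; first by case: (homfly_trace A0 H_homfly) => [[]].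
apply: braid_invariant_lin.
  exact: kauffman_function_invariant Lp_kauffman.
exact: kauffman_function_invariant Lm_kauffman'.
Qed.

(** The parameters B = A and B = -A have the same B^-2, so one factor serves both Kauffman
    functionals; the HOMFLY--PT part gives a trace with any factor. *)
Lemma defect_full_twist w : defect (w ++ full_twist) = A ^- 2 * defect w.
Proof.
have Th := homfly_trace A0 H_homfly.
have Tp := kauffman_shift_trace I2 Lp_kauffman.
have Tm := kauffman_shift_trace I2' Lm_kauffman'.
pose G w := 1 * (1 * hf (w ++ full_twist) + - A ^- 2 * hf w) + -1 *
  (cp * (1 * kp (w ++ full_twist) + - A ^- 2 * kp w) +
   cm * (1 * km (w ++ full_twist) + - (- A) ^- 2 * km w)).
have T : hecke_trace z G.
  exact: hecke_trace_lin (hecke_trace_lin _ _ (hecke_trace_shift Th) Th)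
    (hecke_trace_lin _ _ Tp Tm).
suff /(_ w) : forall w, G w = 0.
  rewrite /G sqrrN => e; apply/eqP; rewrite -subr_eq0 -e; apply/eqP.
  by rewrite /defect; ring.
have [p1 p2 p3] := kauffman_shift_values I2 A0 z0 Lp_kauffman.
have [m1 m2 m3] := kauffman_shift_values I2' A0' z0 Lm_kauffman'.
have [q1 q2 q3] := full_twist_cancel Th.1.1 Th.2.
have [_ v1 v2 v3] := hecke_values_pos Th; have [v4 v5 v6] := hecke_values_neg Th.
rewrite -/kp -/km -/hf in p1 p2 p3 m1 m2 m3 q1 q2 q3 v1 v2 v3 v4 v5 v6.
have h0 : hf [::] = (V / z) ^+ 2 := homfly_function_nil A0 z0 H_homfly.
have ha : hf [:: pa] = A * (V / z) := homfly_function_a A0 z0 H_homfly.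
have hab : hf [:: pa; pb] = A ^+ 2 := homfly_function_ab H_homfly.
have AA0 : A * A - 1 != 0.
  by have -> : A * A - 1 = A * (A - A^-1); [field | rewrite mulf_neq0].
apply: (hecke_trace_eq0_neg T).
- rewrite /G p1 m1 q1 v3 v4 h0 ha hab /cp /cm /V.
  by field; rewrite ?A0' ?A0 ?z0 ?AA0 ?two0.
- rewrite /G p2 m2 q2 v2 v5 h0 ha hab /cp /cm /V.
  by field; rewrite ?A0' ?A0 ?z0 ?AA0 ?two0.
rewrite /G p3 m3 q3 v1 v6 h0 ha hab /cp /cm /V.
by field; rewrite ?A0' ?A0 ?z0 ?AA0 ?two0.
Qed.

(** The defects at exponents n + 2, n and n - 2 satisfy a two-term recurrence for odd n, and they
    vanish at the exponents 1 and -1. *)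
Lemma defect_odd m : defect ([:: pa] ++ wexp [:: pb] (1 + 2 * m)) = 0.
Proof.
have AA0 : A * A - 1 != 0.
  by have -> : A * A - 1 = A * (A - A^-1); [field | rewrite mulf_neq0].
have Th := homfly_trace A0 H_homfly.
have ab b : defect [:: pa; (true, b)] = 0.
  rewrite /defect /kp /km (kauffman_function_ab I2 A0 Lp_kauffman).
  rewrite (kauffman_function_ab I2' A0' Lm_kauffman') sqrrN.
  have h0 : hf [::] = (V / z) ^+ 2 := homfly_function_nil A0 z0 H_homfly.
  have ha : hf [:: pa] = A * (V / z) := homfly_function_a A0 z0 H_homfly.
  have hab : hf [:: pa; pb] = A ^+ 2 := homfly_function_ab H_homfly.
  have [v1 _ _ _] := hecke_values_pos Th; rewrite -/hf hab ha in v1.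
  case: b; rewrite ?hab ?v1 /cp /cm /V; field; by rewrite ?A0' ?A0 ?z0 ?AA0 ?two0.
(* [E n] collects the turnback terms of the two Kauffman recurrences. *)
pose E n := cp * (A * (- A) ^ (- n)) + cm * (- A * A ^ (- n)).
have st n : defect ([:: pa] ++ wexp [:: pb] (n + 1)) -
    defect ([:: pa] ++ wexp [:: pb] (n - 1)) =
    z * (defect ([:: pa] ++ wexp [:: pb] n) - E n).
  have eh := hecke_wexp Th n.
  have ep := kauffman_function_wexp I2 A0 Lp_kauffman n.
  have em := kauffman_function_wexp I2' A0' Lm_kauffman' n; rewrite opprK in em.
  rewrite -/hf -/kp -/km in eh ep em.
  rewrite /defect /E; set w := [:: pa] ++ wexp [:: pb] n in eh ep em *.
  transitivity (1 * (z * hf w) - (cp * (z * (kp w + A * (- A) ^ (- n))) +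
    cm * (z * (km w + - A * A ^ (- n))))); last by ring.
  by rewrite -eh -ep -em; ring.
have nA0 := A0'.
have ES n : E (n + 1) = cp * (A * (- A) ^ (- n) * - A^-1) - cm * A ^ (- n).
  by rewrite /E opprD !(expfzDr _ _ nA0) !(expfzDr _ _ A0) !exprN1 invrN; field.
have EB n : E (n - 1) = - cp * (A * (- A) ^ (- n) * A) - cm * (A * A ^ (- n) * A).
  by rewrite /E opprB addrC !(expfzDr _ _ nA0) !(expfzDr _ _ A0) !expr1z; ring.
(* For odd n, (-A)^-n = -A^-n. Hence [E n] is -(cp + cm) A^(1-n), and its neighbours involve cp - cm
   = -z / V; this is where the coefficient z / (A - A^-1) of the relation enters. *)
have EE k : z * E (1 + 2 * k) + E (1 + 2 * k + 1) - E (1 + 2 * k - 1) = 0.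
  rewrite ES EB /E.
  have -> : (- A) ^ (- (1 + 2 * k)) = - A ^ (- (1 + 2 * k)).
    rewrite opprD !(expfzDr _ _ nA0) !(expfzDr _ _ A0) !exprN1 invrN -mulrN.
    by rewrite -!exprz_exp -[(- A) ^ 2]/((- A) ^+ 2) sqrrN mulNr.
  move: (A ^ _) => Y; rewrite /cp /cm /V.
  by field; rewrite ?A0' ?A0 ?z0 ?AA0 ?two0.
move: m; apply: (@recurrence_unique _ (z ^+ 2 + 2) _ (fun=> 0)) => [m|m||].
(* Three instances of [st] eliminate the even exponents n + 1 and n - 1, and the turnback terms left
   over are [z] times the combination that vanishes by [EE]. *)
- pose n : int := 1 + 2 * m.
  have -> : 1 + 2 * (m + 1) = n + 1 + 1 :> int by rewrite /n; ring.
  have -> : 1 + 2 * (m - 1) = n - 1 - 1 :> int by rewrite /n; ring.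
  have e0 : z * E n + E (n + 1) - E (n - 1) = 0 := EE m.
  have e1 := st n; have e2 := st (n - 1); have e3 := st (n + 1).
  rewrite (_ : n - 1 + 1 = n) in e2; last by ring.
  rewrite (_ : n + 1 - 1 = n) in e3; last by ring.
  move: e1 e2 e3.
  set d0 := defect (_ ++ wexp _ n); set d1 := defect (_ ++ wexp _ (n + 1)).
  set d2 := defect (_ ++ wexp _ (n - 1)); set d3 := defect (_ ++ wexp _ (n + 1 + 1)).
  set d4 := defect (_ ++ wexp _ (n - 1 - 1)) => e1 e2 e3.
  have -> : d3 = z * (d1 - E (n + 1)) + d0 by rewrite -e3 subrK.
  have -> : d4 = d0 - z * (d2 - E (n - 1)) by rewrite -e2 opprB addrC subrK.
  have -> : d1 = z * (d0 - E n) + d2 by rewrite -e1 subrK.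
  rewrite -[RHS]subr0 -(mulr0 z) -e0; ring.
- by rewrite addr0 mulr0.
- exact: (ab true).
exact: (ab false).
Qed.

Lemma defect_normal_word m p : defect (normal_word (1 + 2 * m) p) = 0.
Proof.
elim/int_bi_ind: p => [|p]; first by rewrite /normal_word cats0 defect_odd.
have -> : defect (normal_word (1 + 2 * m) (p + 1)) =
    A ^- 2 * defect (normal_word (1 + 2 * m) p).
  rewrite -defect_full_twist; apply: braid_eqE defect_invariant _.
  rewrite /normal_word -!catA; apply: (@braid_eq_cat [:: pa]) => //.
  by apply: braid_eq_cat => //; apply: wexpS.
split=> [->|]; first by rewrite mulr0.
by apply: contra_eq => d0; rewrite mulf_neq0 // invr_eq0 expf_neq0.
Qed.

End Relation.

Unset Implicit Arguments.

(* F is any field of characteristic 0 with a square root I of -1, so that A, z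
   and q may be complex numbers or indeterminates. *)
Theorem theorem4p1 (F : fieldType) (charF : [pchar F] =i pred0)
  (I : F) (I2 : I ^+ 2 = -1)
  (H : F -> F -> odiagram -> F)
  (L : F -> F -> udiagram -> F)
  (H_homfly : forall A z : F, A != 0 -> z != 0 -> is_homfly A z (H A z))
  (L_kauffman : forall A z : F, A != 0 -> z != 0 -> is_kauffman A z (L A z))
  (neg : bool) (j k l : int) :
  HZ_factorisable H 3 (Kjkl neg j k l) /\
  (forall A z : F, A != 0 -> z != 0 -> A - A^-1 != 0 ->
     let K := braid_closure 3 (Kjkl neg j k l) in
     H A z K = KF_even I L K A z - z / (A - A^-1) * KF_odd I L K A z).
Proof.
split=> [|A z A0 z0 V0 K]; first exact: family_HZ.
have I0 : I != 0.
  by apply: contra_eq_neq I2 => ->; rewrite expr0n /= eq_sym oppr_eq0 oner_eq0.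
have two0 : 2%:R != 0 :> F by have := charF 2; rewrite !inE /= => ->.
have Hh := H_homfly A z A0 z0.
have IA0 : I * A != 0 by rewrite mulf_neq0.
have Iz0 : I * z != 0 by rewrite mulf_neq0.
have Lp := L_kauffman (I * A) (I * z) IA0 Iz0.
have Lm : is_kauffman (I * A) (- (I * z)) (L (I * A) (- (I * z))).
  by apply: L_kauffman; rewrite ?oppr_eq0.
have [m nm] := family_exponent_odd neg j k.
set W := normal_word (1 + 2 * m) (l + k).
have KW : braid_eq (family_word neg j k l) W by rewrite /W -nm; apply: family_wordE.
have wW : writhe_word W = 2 * (1 + m + 3 * (l + k)).
  by rewrite writhe_normal_word; ring.
have wK : writhe K = writhe_word W.
  rewrite /K Kjkl_word braid_closure_word writhe_closure.
  exact: braid_eqE writhe_word_invariant KW.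
have HK : H A z K = H A z (closure3 true W).
  by rewrite /K Kjkl_word braid_closure_word (homfly_braid_eq Hh KW).
have LK a x : is_kauffman a x (L a x) -> L a x (erase K) = L a x (closure3 tt W).
  case=> Li _ _ _; rewrite /K Kjkl_word braid_closure_word erase_closure.
  exact: braid_eqE (closure3_invariant Li tt) KW.
(* The even writhe makes the powers of [I] and [- I] agree, so that [defect] is the difference of
   the two sides up to a power of [A]. *)
have even : (- I) ^ (- writhe_word W) = I ^ (- writhe_word W).
  by rewrite wW -mulrN -!exprz_exp -[(- I) ^ 2]/((- I) ^+ 2) sqrrN.
have := defect_normal_word two0 I2 A0 z0 V0 Hh Lp Lm m (l + k).
rewrite /defect /homfly_function /kauffman_function -/W even => e.
rewrite /KF_even /KF_odd /KF HK !LK // wK expfzMl.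
set x := L _ _ _ in e *; set y := L _ (- _) _ in e *.
have AW0 : A ^ writhe_word W != 0 by rewrite expfz_neq0.
apply: (mulfI AW0).
have AW : A ^ (- writhe_word W) = (A ^ writhe_word W)^-1 by rewrite invr_expz.
rewrite AW; set c := I ^ _ in e *; set a := A ^ _ in e AW0 *.
transitivity (2%:R^-1 * (1 - z / (A - A^-1)) * (c * x) +
  2%:R^-1 * (1 + z / (A - A^-1)) * (c * y)).
  by apply/eqP; rewrite -subr_eq0 -e; apply/eqP; ring.
transitivity ((a * a^-1) * (2%:R^-1 * (1 - z / (A - A^-1)) * (c * x) +
  2%:R^-1 * (1 + z / (A - A^-1)) * (c * y))); first by rewrite mulfV // mul1r.
by ring.
Qed.
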